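(* Let $\mathrm{GL}^a(n)$ be the parabolic contraction of $\mathrm{GL}(n,\mathbb F_q)$ with respect to the parabolic subgroup given by the segments $I_1,\dots,I_\ell$, let $U^a=1+\mathfrak u^a$, and let $D$ run through a system of representatives of the $W_L\times W_L$-orbits of rook placements in $\Delta(\mathfrak u^a)$. For each such $D$ put $$\zeta_D(u)=\frac{|\Lambda_DU^a|}{|\mathrm{GL}^a(n)\Lambda_D\mathrm{GL}^a(n)|}\sum_{\mu\in \mathrm{GL}^a(n)\Lambda_D\mathrm{GL}^a(n)}\varepsilon^{\mu(X)},\qquad u=1+X\in U^a,$$ and $K_D=1+\mathrm{GL}^a(n)X_D\mathrm{GL}^a(n)$. Then the system of characters $\{\zeta_D\}$ and the decomposition of the group $U^a$ into the classes $\{K_D\}$ give rise to a supercharacter theory of the group $U^a$.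
   Context: A supercharacter theory of a finite group $G$ is a pair $(\{\chi_1,\dots,\chi_M\},\{K_1,\dots,K_M\})$, where $\chi_1,\dots,\chi_M$ are pairwise disjoint complex characters of $G$, $\{K_1,\dots,K_M\}$ is a partition of $G$ with $\{1\}$ among its members, and every $\chi_i$ is constant on every $K_j$ (the number of characters equals the number of classes). $\mathbb F_q$ is a finite field of $q$ elements of characteristic $\neq 2$; $t\mapsto\varepsilon^t$ is a fixed nontrivial character of $(\mathbb F_q,+)$ with values in $\mathbb C^*$. Write $[1,n]=I_1\sqcup\dots\sqcup I_\ell$ as a union of consecutive segments (in increasing order), $n_i=|I_i|$. All matrices are $n\times n$ over $\mathbb F_q$, with blocks $I_k\times I_m$. $\mathfrak p$ is the algebra of block upper triangular matrices, $\mathfrak u_+$ the strictly block upper triangular matrices, $L=\mathrm{GL}(n_1)\times\dots\times\mathrm{GL}(n_\ell)$ the block diagonal group. $\mathfrak u_-^a$ is the dual space $\mathfrak u_+^*$, identified with the space of strictly block lower triangular matrices via $\lambda(x)=\mathrm{Tr}(\lambda x)$. The associative algebra $\mathfrak{gl}^a(n)=\mathfrak p\oplus\mathfrak u_-^a$ has the matrix multiplication on $\mathfrak p$, zero multiplication on $\mathfrak u_-^a$, and $(t\lambda)(x)=\lambda(xt)$, $(\lambda t)(x)=\lambda(tx)$ for $t\in\mathfrak p$, $\lambda\in\mathfrak u^a_-$, $x\in\mathfrak u_+$. The parabolic contraction $\mathrm{GL}^a(n)$ is the group of invertible elements of $\mathfrak{gl}^a(n)$. $\mathfrak u^a=\mathfrak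 u_+\oplus\mathfrak u_-^a$ is a nilpotent two-sided ideal and $U^a=1+\mathfrak u^a$. $\mathrm{GL}^a(n)$ acts on $(\mathfrak u^a)^*$ from the left and right by $(g\Lambda)(X)=\Lambda(Xg)$, $(\Lambda g)(X)=\Lambda(gX)$. $\Delta(\mathfrak u^a)$ is the set of pairs (roots) $(i,j)\in I_k\times I_m$ with $k\ne m$. Those with $k<m$ are positive, with matrix unit $E_{(i,j)}\in\mathfrak u_+$; those with $k>m$ are negative, with matrix unit $F_{(i,j)}\in\mathfrak u_-^a$. These matrix units form a basis of $\mathfrak u^a$; $E^*_\gamma,F^*_\gamma$ is the dual basis of $(\mathfrak u^a)^*$. A rook placement is a subset $D$ with at most one element in each row and each column; $D_\pm$ denotes its set of positive/negative elements. Put $X_D=\sum_{\gamma\in D_+}E_\gamma+\sum_{\gamma\in D_-}F_\gamma$ and $\Lambda_D=\sum_{\gamma\in D_+}E^*_\gamma+\sum_{\gamma\in D_-}F^*_\gamma$. $W_L=S_{I_1}\times\dots\times S_{I_\ell}$ is the Weyl group of $L$; $(w_1,w_2)\in W_L\times W_L$ acts on roots by $w_1(i,j)w_2=(w_1(i),w_2^{-1}(j))$.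
   Formalization: ζ_D as defined need not be a character (n=2, blocks {1},{2}, q=3, D={(1,2)}: it takes the value −1/2), so the theorem is proved for N_D·ζ_D, where N_D is the number of U^a×U^a-orbits in GL^a(n)Λ_D GL^a(n). *)

(* Defs.v *)
From HB Require Import structures.
From mathcomp Require Import all_boot all_order all_algebra.
From mathcomp Require Import all_fingroup all_solvable all_field all_character.

Set Implicit Arguments.
Unset Strict Implicit.
Unset Printing Implicit Defensive.

Import GroupScope GRing.Theory.
Local Open Scope ring_scope.

(* Complex characters are taken with values in algC.
   J indexes both the characters and the classes.  The library predicate
   [character] accepts the zero class function, hence the condition != 0. *)
Definition supercharacter_theory (gT : finGroupType) (G : {group gT})
    (T : finType) (J : {set T}) (chi : T -> 'CF(G)) (K : T -> {set gT}) : Prop :=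
  [/\ {in J, forall i, chi i \is a character /\ chi i != 0},
      {in J &, forall i j, i != j ->
         [disjoint irr_constt (chi i) & irr_constt (chi j)]},
      {in J &, injective K} /\ partition [set K j | j in J] G,
      [set 1%g] \in [set K j | j in J]
    & {in J &, forall i j, {in K j &, forall x y, chi i x = chi i y}}].

(* The decomposition of [1,n], n >= 1, into nonempty consecutive segments is
   given by the map sending i to the k with i in I_k. *)
Record segments (n : nat) := Segments {
  nseg : nat;
  blk : 'I_n -> 'I_nseg;
  segments_gt0 : (0 < n)%N;
  blk_homo : {homo blk : i j / (i <= j)%N};
  blk_surj : forall k, exists i, blk i = k }.

(* The algebra gl^a(n).  A matrix A stands for (up_part A, low_part A) in
   p (+) u_-^a, where low_part A is the functional x |-> \tr (low_part A *m x)
   on u_+; see mul_up_low_tr and mul_low_up_tr.  The multiplication gla_mul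
   depends on I. *)
Definition gla (F : finFieldType) (n : nat) (I : segments n) : Type := 'M[F]_n.

Section Contraction.
Variables (F : finFieldType) (n : nat) (I : segments n).
Local Notation M := 'M[F]_n.

Definition up_part (A : M) : M :=
  \matrix_(i, j) (if (blk I i <= blk I j)%N then A i j else 0).
Definition low_part (A : M) : M :=
  \matrix_(i, j) (if (blk I j < blk I i)%N then A i j else 0).

Local Notation glaI := (gla F I).
HB.instance Definition _ := GRing.Zmodule.on glaI.
HB.instance Definition _ := Finite.on glaI.

Definition gla_mul (A B : glaI) : glaI :=
  up_part A *m up_part B
  + low_part (up_part A *m low_part B + low_part A *m up_part B).

Lemma up_partD : {morph up_part : A B / A + B}.
Proof. by move=> A B; apply/matrixP=> i j; rewrite !mxE; case: ifP; rewrite ?addr0. Qed.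

Lemma low_partD : {morph low_part : A B / A + B}.
Proof. by move=> A B; apply/matrixP=> i j; rewrite !mxE; case: ifP; rewrite ?addr0. Qed.

Lemma up_low A : up_part A + low_part A = A.
Proof.
apply/matrixP=> i j; rewrite !mxE.
by case: leqP; rewrite ?addr0 ?add0r.
Qed.

Lemma up_up A : up_part (up_part A) = up_part A.
Proof. by apply/matrixP=> i j; rewrite !mxE; case: (_ <= _)%N. Qed.

Lemma low_low A : low_part (low_part A) = low_part A.
Proof. by apply/matrixP=> i j; rewrite !mxE; case: (_ < _)%N. Qed.

Lemma up_of_low A : up_part (low_part A) = 0.
Proof. by apply/matrixP=> i j; rewrite !mxE; case: leqP. Qed.

Lemma low_of_up A : low_part (up_part A) = 0.
Proof. by apply/matrixP=> i j; rewrite !mxE; case: ltnP. Qed.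

Lemma up_mul A B : up_part (up_part A *m up_part B) = up_part A *m up_part B.
Proof.
apply/matrixP=> i j; rewrite !mxE; case: leqP => // lt_ji.
apply/esym/big1=> k _; rewrite !mxE.
case: leqP => [le_ik|]; last by rewrite mul0r.
by rewrite leqNgt (leq_trans lt_ji le_ik) mulr0.
Qed.

Lemma low_mul A B : low_part (up_part A *m up_part B) = 0.
Proof. by rewrite -up_mul low_of_up. Qed.

Lemma low_mulr A B : low_part (low_part A *m up_part B) = low_part (A *m up_part B).
Proof. by rewrite -{2}(up_low A) mulmxDl low_partD low_mul add0r. Qed.

Lemma low_mull A B : low_part (up_part A *m low_part B) = low_part (up_part A *m B).
Proof. by rewrite -{2}(up_low B) mulmxDr low_partD low_mul add0r. Qed.

Lemma up_gla_mul A B : up_part (gla_mul A B) = up_part A *m up_part B.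
Proof. by rewrite up_partD up_mul up_of_low addr0. Qed.

Lemma low_gla_mul A B : low_part (gla_mul A B)
  = low_part (up_part A *m low_part B + low_part A *m up_part B).
Proof. by rewrite low_partD low_mul low_low add0r. Qed.

Lemma gla_mulA : associative gla_mul.
Proof.
move=> A B C; rewrite {1}/gla_mul [RHS]/gla_mul !up_gla_mul !low_gla_mul.
rewrite mulmxA; congr (_ + _).
rewrite [in LHS]low_partD low_mull [in RHS]low_partD low_mulr.
by rewrite -!low_partD mulmxDr mulmxDl !mulmxA addrA.
Qed.

Lemma up1 : up_part 1%:M = 1%:M.
Proof.
apply/matrixP=> i j; rewrite !mxE; case: eqP => [->|_]; first by rewrite leqnn.
by case: ifP.
Qed.

Lemma low1 : low_part 1%:M = 0.
Proof. by rewrite -up1 low_of_up. Qed.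

Lemma gla_mul1 : left_id (1%:M : glaI) gla_mul.
Proof. by move=> A; rewrite /gla_mul up1 low1 mul0mx addr0 !mul1mx low_low up_low. Qed.

Lemma gla_1mul : right_id (1%:M : glaI) gla_mul.
Proof. by move=> A; rewrite /gla_mul up1 low1 mulmx0 add0r !mulmx1 low_low up_low. Qed.

Lemma gla_mulDl : left_distributive gla_mul +%R.
Proof.
move=> A B C; rewrite /gla_mul !up_partD !low_partD !mulmxDl !low_partD.
by rewrite [RHS]addrACA; congr (_ + _); rewrite addrACA.
Qed.

Lemma gla_mulDr : right_distributive gla_mul +%R.
Proof.
move=> A B C; rewrite /gla_mul !up_partD !low_partD !mulmxDr !low_partD.
by rewrite [RHS]addrACA; congr (_ + _); rewrite addrACA.
Qed.

Lemma gla_1neq0 : (1%:M : glaI) != 0.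
Proof.
apply/eqP=> /matrixP/(_ (Ordinal (segments_gt0 I)) (Ordinal (segments_gt0 I))).
by rewrite !mxE eqxx => /eqP; rewrite oner_eq0.
Qed.

HB.instance Definition _ := GRing.Zmodule_isNzRing.Build glaI
  gla_mulA gla_mul1 gla_1mul gla_mulDl gla_mulDr gla_1neq0.
HB.instance Definition _ := FinRing.isNzRing.Build glaI.

Lemma glaM (A B : glaI) : A * B = up_part A *m up_part B
  + low_part (up_part A *m low_part B + low_part A *m up_part B).
Proof. by []. Qed.

Lemma low_mulmx_tr (A x : M) :
  (forall i j, (blk I j <= blk I i)%N -> x i j = 0) ->
  \tr (low_part A *m x) = \tr (A *m x).
Proof.
move=> x0; apply: eq_bigr => i _; rewrite !mxE; apply: eq_bigr => j _.
rewrite mxE; case: ltnP => // le_ij.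
by rewrite x0 // !mulr0.
Qed.

Lemma mul_up_low_tr (t l : glaI) (x : M) :
    low_part t = 0 -> up_part l = 0 ->
    (forall i j, (blk I j <= blk I i)%N -> x i j = 0) ->
  \tr ((t * l) *m x) = \tr (l *m (x *m t)).
Proof.
move=> t0 l0 x0.
rewrite glaM t0 l0 mulmx0 mul0mx add0r addr0 low_mulmx_tr //.
rewrite -{2}(up_low t) t0 addr0 -{2}(up_low l) l0 add0r.
by rewrite -mulmxA mxtrace_mulC mulmxA.
Qed.

Lemma mul_low_up_tr (t l : glaI) (x : M) :
    low_part t = 0 -> up_part l = 0 ->
    (forall i j, (blk I j <= blk I i)%N -> x i j = 0) ->
  \tr ((l * t) *m x) = \tr (l *m (t *m x)).
Proof.
move=> t0 l0 x0.
rewrite glaM t0 l0 mul0mx mulmx0 !add0r low_mulmx_tr //.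
rewrite -{2}(up_low t) t0 addr0 -{2}(up_low l) l0 add0r.
by rewrite -mulmxA.
Qed.

(* {unit gla F I} is the parabolic contraction GL^a(n). *)
Local Notation GLa := {unit glaI}.

Definition in_ua (X : glaI) : bool :=
  [forall i, forall j, (blk I i == blk I j) ==> ((X : M) i j == 0)].

Lemma in_uaP (X : glaI) : reflect (forall i j, blk I i = blk I j -> (X : M) i j = 0) (in_ua X).
Proof.
apply: (iffP forallP) => [H i j /eqP Hij | H i].
  by apply/eqP; move: (H i) => /forallP/(_ j)/implyP/(_ Hij).
by apply/forallP=> j; apply/implyP=> /eqP/H->.
Qed.

Lemma in_ua0 : in_ua 0.
Proof. by apply/in_uaP=> i j _; rewrite mxE. Qed.

Lemma in_uaD X Y : in_ua X -> in_ua Y -> in_ua (X + Y).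
Proof.
by move=> /in_uaP hX /in_uaP hY; apply/in_uaP=> i j e; rewrite mxE hX ?hY ?addr0.
Qed.

Lemma in_uaMl (A X : glaI) : in_ua X -> in_ua (A * X).
Proof.
move=> /in_uaP hX; apply/in_uaP=> i j e.
rewrite mxE [X in _ + X]mxE e ltnn addr0 mxE big1 // => k _; rewrite !mxE.
case: leqP => [le_ik|]; last by rewrite mul0r.
case: leqP => [le_kj|]; last by rewrite mulr0.
by rewrite hX ?mulr0 //; apply/val_inj/eqP; rewrite eqn_leq le_kj -e.
Qed.

Lemma in_uaMr (A X : glaI) : in_ua X -> in_ua (X * A).
Proof.
move=> /in_uaP hX; apply/in_uaP=> i j e.
rewrite mxE [X in _ + X]mxE e ltnn addr0 mxE big1 // => k _; rewrite !mxE.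
case: leqP => [le_ik|]; last by rewrite mul0r.
case: leqP => [le_kj|]; last by rewrite mulr0.
by rewrite hX ?mul0r //; apply/val_inj/eqP; rewrite eqn_leq le_ik e.
Qed.

(* u^a is nilpotent, so 1 + u^a consists of units. *)
Lemma up_ua_exp (X : glaI) k (i j : 'I_n) :
  in_ua X -> (blk I j < blk I i + k)%N -> up_part (X ^+ k) i j = 0.
Proof.
move=> /in_uaP hX; elim: k i j => [|k IHk] i j.
  rewrite addn0 expr0 => lt_ji.
  by rewrite [up_part _]up1 mxE; case: eqP lt_ji => // ->; rewrite ltnn.
rewrite addnS => lt_j; rewrite exprS [up_part _]up_gla_mul mxE big1 // => m _.
have [lt_im|] := ltnP (blk I i) (blk I m).
  by rewrite IHk ?mulr0 // (leq_trans lt_j) // ltn_add2r.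
rewrite mxE leq_eqVlt => /orP[/eqP e|lt_mi]; last by rewrite leqNgt lt_mi mul0r.
by rewrite e leqnn hX ?mul0r //; apply: val_inj.
Qed.

Lemma ua_nilpotent (X : glaI) : in_ua X -> X ^+ (nseg I + nseg I) = 0.
Proof.
move=> hX; have up0 : up_part (X ^+ nseg I) = 0.
  apply/matrixP=> i j; rewrite up_ua_exp ?mxE //.
  by apply: leq_trans (ltn_ord _) (leq_addl _ _).
rewrite exprD glaM up0 !mul0mx mulmx0 addr0 add0r.
by apply/matrixP=> i j; rewrite !mxE; case: ifP.
Qed.

Lemma unit_1ua (X : glaI) : in_ua X -> 1 + X \is a GRing.unit.
Proof.
move=> hX; set Y := - X; set N := (nseg I + nseg I)%N.
have Y0 : Y ^+ N = 0 by rewrite exprNn (ua_nilpotent hX) mulr0.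
have -> : 1 + X = - (Y - 1) by rewrite opprB opprK.
rewrite unitrN; apply/unitrP; exists (- \sum_(i < N) Y ^+ i).
have eq1 : (Y - 1) * (- \sum_(i < N) Y ^+ i) = 1.
  by rewrite mulrN -subrX1 Y0 sub0r opprK.
split=> //; rewrite -[RHS]eq1; apply/esym/commrN/commr_sum => i _.
by apply/commrX/commr_sym/commrB; [apply: commr_refl | apply: commr1].
Qed.

Definition Ua_set : {set GLa} := [set u : GLa | in_ua (val u - 1)].

Lemma Ua_group_set : group_set Ua_set.
Proof.
apply/group_setP; split=> [|u v]; first by rewrite inE subrr in_ua0.
rewrite !inE => Uu Uv.
have -> : val (u * v)%g - 1 = (val u - 1) * val v + (val v - 1).
  by rewrite mulrBl mul1r addrA subrK.
by rewrite in_uaD ?in_uaMr.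
Qed.

Canonical Ua := Group Ua_group_set.

Definition ua : Type := {X : glaI | in_ua X}.
HB.instance Definition _ := Finite.on ua.
HB.instance Definition _ := SubType.on ua.

Definition ua_mull (g : GLa) (X : ua) : ua := Sub (val g * val X) (in_uaMl (val g) (valP X)).
Definition ua_mulr (X : ua) (g : GLa) : ua := Sub (val X * val g) (in_uaMr (val g) (valP X)).

(* The X in u = 1 + X, for u in U^a. *)
Definition ua_of (u : GLa) : ua := insubd (Sub 0 in_ua0) (val u - 1).

Lemma ua_ofK (u : GLa) : u \in Ua -> val (ua_of u) = val u - 1.
Proof. by rewrite inE => Uu; rewrite /ua_of insubdK. Qed.

(* Elements of (u^a)^* are functions on u^a; those considered here lie in the
   GL^a(n)-orbits of the linear functions Lambda D. *)
Local Notation functional := {ffun ua -> F}.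

Definition lact (g : GLa) (L : functional) : functional :=
  [ffun X => L (ua_mulr X g)].
Definition ract (L : functional) (g : GLa) : functional :=
  [ffun X => L (ua_mull g X)].

Lemma lactM g h L : lact g (lact h L) = lact (g * h)%g L.
Proof.
by apply/ffunP=> X; rewrite !ffunE; congr (L _); apply: val_inj; rewrite /= mulrA.
Qed.

Lemma ractM g h L : ract (ract L g) h = ract L (g * h)%g.
Proof.
by apply/ffunP=> X; rewrite !ffunE; congr (L _); apply: val_inj; rewrite /= mulrA.
Qed.

Lemma lract g h L : lact g (ract L h) = ract (lact g L) h.
Proof.
by apply/ffunP=> X; rewrite !ffunE; congr (L _); apply: val_inj; rewrite /= mulrA.
Qed.

Definition rorbit (H : {set GLa}) (L : functional) : {set functional} :=
  [set ract L h | h in H].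
Definition biorbit (H : {set GLa}) (L : functional) : {set functional} :=
  [set ract (lact g L) h | g in H, h in H].

Definition is_root (r : 'I_n * 'I_n) : bool := blk I r.1 != blk I r.2.

Definition rook_placement (D : {set 'I_n * 'I_n}) : bool :=
  [forall r in D, is_root r]
  && [forall r in D, forall s in D, (r.1 == s.1) || (r.2 == s.2) ==> (r == s)].

(* In the matrix encoding of gla both E_(i,j) and F_(i,j) are delta_mx i j. *)
Definition X_ (D : {set 'I_n * 'I_n}) : glaI := \sum_(r in D) delta_mx r.1 r.2.
Definition Lambda (D : {set 'I_n * 'I_n}) : functional :=
  [ffun X : ua => \sum_(r in D) (val X : M) r.1 r.2].

Definition WL : {set {perm 'I_n}} := [set w : {perm 'I_n} | [forall i, blk I (w i) == blk I i]].

Definition WL_act (w1 w2 : {perm 'I_n}) (D : {set 'I_n * 'I_n}) :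
    {set 'I_n * 'I_n} :=
  [set (w1 r.1, (w2^-1)%g r.2) | r in D].

Definition WL_orbit (D : {set 'I_n * 'I_n}) : {set {set 'I_n * 'I_n}} :=
  [set WL_act w1 w2 D | w1 in WL, w2 in WL].

Definition rook_representatives (R : {set {set 'I_n * 'I_n}}) : bool :=
  is_transversal R [set WL_orbit D | D in rook_placement]
                   [set D | rook_placement D].

Definition superclass (D : {set 'I_n * 'I_n}) : {set GLa} :=
  [set u : GLa | [exists g : GLa, exists h : GLa, val u == 1 + val g * X_ D * val h]].

Section Zeta.
Variables (eps : F -> algC) (D : {set 'I_n * 'I_n}).

Definition zeta_fun (u : GLa) : algC :=
  if u \in Ua then
    #|rorbit Ua (Lambda D)|%:R / #|biorbit setT (Lambda D)|%:R
    * \sum_(mu in biorbit setT (Lambda D)) eps (mu (ua_of u))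
  else 0.

Lemma zeta_class_fun : is_class_fun <<Ua>> (finfun zeta_fun).
Proof.
rewrite genGid; apply: intro_class_fun => [u v Uu Uv | u /negPf nUu]; last first.
  by rewrite /zeta_fun nUu.
rewrite /zeta_fun groupJ // Uu; congr (_ * _).
pose phi w (L : functional) := ract (lact w L) w^-1%g.
have phiK w : cancel (phi w) (phi w^-1%g).
  move=> L; rewrite /phi lract lactM ractM mulVg invgK mulVg.
  by apply/ffunP=> X; rewrite !ffunE; congr (L _); apply: val_inj; rewrite /= mul1r mulr1.
have phi_bi w : {homo phi w : L / L \in biorbit setT (Lambda D)}.
  move=> _ /imset2P[g h _ _ ->]; apply/imset2P.
  exists (w * g)%g (h * w^-1)%g; rewrite ?inE //.
  by rewrite /phi lract lactM ractM.
rewrite (reindex_inj (can_inj (phiK v^-1%g))) /=; apply: eq_big => [L | L _].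
  apply/idP/idP => [/(phi_bi v) | /phi_bi//].
  by rewrite -{1}[v]invgK phiK.
congr eps; rewrite !ffunE; congr (L _); apply: val_inj => /=.
rewrite -![sval _]/(val _) !ua_ofK ?groupJ // invrK conjgE.
rewrite !FinRing.val_unitM FinRing.val_unitV mulrBr mulr1 mulrBl.
by rewrite -!mulrA mulVKr ?mulrV ?mulr1 //; case: (v).
Qed.

Definition zeta : 'CF(Ua) := Cfun 0 zeta_class_fun.

End Zeta.

(* The number of U^a x U^a-orbits in GL^a(n) Lambda_D GL^a(n).  The class
   function zeta D is the average, over these orbits O, of the characters
   |mu U^a| / |O| * \sum_(nu in O) eps (nu X), mu in O.  It is not a character
   itself: for n = 2, #|F| = 3, two segments and D = {(1,2)}, its values are
   1 and -1/2.  The sum of these characters is nb_Ua_orbits D *: zeta D. *)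
Definition nb_Ua_orbits (D : {set 'I_n * 'I_n}) : nat :=
  #|[set biorbit Ua mu | mu in biorbit setT (Lambda D)]|.

End Contraction.

(* Main.v *)
Require Import Defs.
From HB Require Import structures.
From mathcomp Require Import all_boot all_order all_algebra.
From mathcomp Require Import all_fingroup all_solvable all_field all_character.
From mathcomp Require Import zify ring.

(* The algebra gl^a(n) is a quotient J / tJ of the parahoric order J in
   M_n(F[[t]]) attached to the segments: arrange the blocks on a circle of
   length l; then an entry (i, j) has degree the number of steps from the block
   of i to the block of j, and a product of matrix units survives exactly when
   the degrees add up to less than l.

   Orbits on u^a: choosing a pivot of minimal degree, its row and column can be
   cleared by multiplications, which leads to some X_D.  Cutting the circle
   before any block and restricting to a window of consecutive blocks gives a
   ring morphism into triangular matrices; the ranks of the windows of X_D are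
   therefore invariants of the orbit, and they determine how many elements D
   has in each pair of blocks, that is, D up to W_L x W_L.

   The form tr(YX) identifies u^a with its dual as a bimodule, and Lambda_D
   with the transpose of X_D, so the orbits on the dual are known as well.

   Characters: the normalized sum of eps o nu over a U^a-biorbit U mu U is
   induced from the linear character u |-> eps (mu (u - 1)) of the right
   stabilizer of mu.  Sums over disjoint biorbits are orthogonal because
   distinct characters of the additive group u^a are. *)

Set Implicit Arguments.
Unset Strict Implicit.
Unset Printing Implicit Defensive.

Import GroupScope GRing.Theory Num.Theory.
Local Open Scope ring_scope.

(** * Matching finite families by the sizes of their fibers *)

Lemma bij_of_fibers (T : eqType) m m' (f : 'I_m -> T) (g : 'I_m' -> T) :
    m = m' ->
    (forall t, \sum_(i < m) (f i == t) = \sum_(i < m') (g i == t))%N ->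
  exists2 w : 'I_m -> 'I_m', bijective w & forall i, g (w i) = f i.
Proof.
move=> mm'; case: m' / mm' g => g fib.
have cnt (h : 'I_m -> T) t :
    count_mem t [tuple h i | i < m] = (\sum_(i < m) (h i == t))%N.
  by rewrite /= count_map -sumn_count -[sumn _]/(foldr _ _ _) foldrE big_map big_enum.
(* Fiber sizes are multiplicities, so the two tuples of values are permutations of one another. *)
have : perm_eq [tuple f i | i < m] [tuple g i | i < m].
  by apply/allP=> t _ /=; rewrite !cnt fib.
case/tuple_permP=> p /val_inj eqp; exists p.
  by exists p^-1%g; [apply: permK | apply: permKV].
move=> i; have := congr1 (fun s => tnth s i) eqp.
by rewrite !tnth_mktuple.
Qed.

Lemma sum_fibers (T : eqType) (J : finType) n (b : 'I_n -> T) (o : 'I_n -> J) k :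
  (\sum_j \sum_(i < n) ((b i, o i) == (k, j)) = \sum_(i < n) (b i == k))%N.
Proof.
rewrite exchange_big; apply: eq_bigr => i _ /=.
rewrite (bigD1 (o i)) //= xpair_eqE eqxx andbT big1 ?addn0 // => j /negPf.
by rewrite xpair_eqE eq_sym => ->; rewrite andbF.
Qed.

Section Extension.
Variables (T : eqType) (n m : nat) (b : 'I_n -> T).
Implicit Types p q : 'I_m -> 'I_n.

(** The label of [i]: its color under [b], together with its preimage under [p] if there is one. A
    bijection carrying the labels for [p] to those for [q] preserves colors and sends [p x] to
    [q x]. *)
Let key p i : T * option 'I_m := (b i, [pick x | p x == i]).

Let pick_inj p x : injective p -> [pick y | p y == p x] = Some x.
Proof.
move=> inj_p; case: pickP => [y /eqP/inj_p-> // | /(_ x)].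
by rewrite eqxx.
Qed.

Let fiber_Some p k x : injective p ->
  (\sum_i (key p i == (k, Some x)) = (b (p x) == k))%N.
Proof.
move=> inj_p; rewrite (bigD1 (p x)) //= big1 => [|i i_neq].
  by rewrite /key pick_inj // xpair_eqE eqxx andbT addn0.
rewrite /key xpair_eqE; case: pickP => [y /eqP yi | _]; last by rewrite andbF.
by case: (Some y =P Some x) => [[yx] | _]; rewrite ?andbF //; rewrite -yi yx eqxx in i_neq.
Qed.

(** The fibers of the labels over [Some x] have at most one point and agree by hypothesis. Those
    over [None] then agree by subtraction from the number of all points of a given color. *)
Lemma extend_to_perm p q : injective p -> injective q ->
    (forall x, b (p x) = b (q x)) ->
  exists2 w : {perm 'I_n}, forall i, b (w i) = b i & forall x, w (p x) = q x.
Proof.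
move=> inj_p inj_q bpq.
have [t | w bij_w keyw] := bij_of_fibers (f := key p) (g := key q) (erefl n).
  case: t => k [x|]; first by rewrite !fiber_Some // bpq.
  have := etrans (sum_fibers b (fun i => [pick x | p x == i]) k)
    (esym (sum_fibers b (fun i => [pick x | q x == i]) k)).
  rewrite (bigD1 None) //= [in RHS](bigD1 None) //=.
  rewrite [X in (_ + X = _)%N](eq_bigr (fun o : option 'I_m =>
    (\sum_i (key q i == (k, o)))%N)) => [|[x|] // _]; first by move/addIn.
  by rewrite -!/(key _ _) !fiber_Some // bpq.
exists (perm (bij_inj bij_w)) => [i | x]; rewrite permE.
  by have [] := keyw i.
have [_] := keyw (p x); rewrite pick_inj //.
by case: pickP => [y /eqP qy [yx] | _ //]; rewrite -qy yx.
Qed.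

End Extension.

(** * Arithmetic of intervals and of distances along the circle *)

Lemma window_inclusion_exclusion b x y : (b != 0)%N -> x != y ->
 ([&& 0 <= x, x <= y & y <= b] + [&& 1 <= x, x <= y & y <= b.-1]
 = [&& 1 <= x, x <= y & y <= b] + [&& 0 <= x, x <= y & y <= b.-1]
   + ((x == 0) && (y == b)))%N.
Proof.
(* For [x = 0] the conditions with lower bound 1 fail, and [y <= b] splits into [y <= b.-1] and
   [y == b]; here [b != 0] makes [b.-1] a true predecessor. For positive [x] the lower bounds 0 and
   1 amount to the same. *)
case: b => // b _; case: x => [|x] /=; last by rewrite addn0 addnC.
move=> y0; rewrite add0n addn0 leq_eqVlt ltnS.
case: eqP => [->|_]; last by rewrite addn0.
by rewrite ltnn.
Qed.

(* The number of steps from a to b along the circle Z/l. *)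
Definition circ_dist (l a b : nat) : nat :=
  if (a <= b)%N then (b - a)%N else (b + l - a)%N.

Lemma circ_dist_inj l c a b : (c < l)%N -> (a < l)%N -> (b < l)%N ->
  (circ_dist l c a == circ_dist l c b) = (a == b).
Proof.
rewrite /circ_dist => *.
by case: (leqP c a) => ?; case: (leqP c b) => ?; apply/eqP/eqP; lia.
Qed.

(** The two distances add up to that from [a] to [b] when [k] lies on the arc from [a] to [b], and
    exceed it by [l] otherwise. Comparing one of them with the whole arc tells which. *)
Lemma circ_dist_addl l a k b : (a < l)%N -> (k < l)%N -> (b < l)%N ->
  (circ_dist l a k + circ_dist l k b == circ_dist l a b)%N
  = (circ_dist l a k <= circ_dist l a b)%N.
Proof.
rewrite /circ_dist => *; case: (leqP a k) => ?; case: (leqP k b) => ?;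
  case: (leqP a b) => ?; apply/eqP/idP; lia.
Qed.

Lemma circ_dist_addr l a k b : (a < l)%N -> (k < l)%N -> (b < l)%N ->
  (circ_dist l a k + circ_dist l k b == circ_dist l a b)%N
  = (circ_dist l k b <= circ_dist l a b)%N.
Proof.
rewrite /circ_dist => *; case: (leqP a k) => ?; case: (leqP k b) => ?;
  case: (leqP a b) => ?; apply/eqP/idP; lia.
Qed.

(** Cutting the circle before [c] orders its points by [circ_dist l c]. If [a] does not come after
    [b] there, the arc from [a] to [b] avoids the cut and becomes an interval. *)
Lemma circ_dist_between l c a k b :
    (c < l)%N -> (a < l)%N -> (k < l)%N -> (b < l)%N ->
    (circ_dist l c a <= circ_dist l c b)%N ->
  (circ_dist l a k + circ_dist l k b == circ_dist l a b)%N
  = (circ_dist l c a <= circ_dist l c k <= circ_dist l c b)%N.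
Proof.
rewrite /circ_dist => ????; case: (leqP c a) => ?; case: (leqP c b) => ?;
  case: (leqP c k) => ?; case: (leqP a k) => ?; case: (leqP k b) => ?;
  case: (leqP a b) => ? ?; try by exfalso; lia.
all: by apply/eqP/andP=> [?|[]]; try split; lia.
Qed.

(** Both equalities say that [a], [k], [b] follow one another in cyclic order. This symmetry is the
    source of the invariance of the trace form. *)
Lemma circ_dist_rotate l a k b : (a < l)%N -> (k < l)%N -> (b < l)%N ->
    k != b -> b != a ->
  (circ_dist l a k + circ_dist l k b == circ_dist l a b)%N
  = (circ_dist l b a + circ_dist l a k == circ_dist l b k)%N.
Proof.
rewrite /circ_dist => ? ? ? ? ?; case: (leqP a k) => ?; case: (leqP k b) => ?;
  case: (leqP b a) => ?; case: (leqP a b) => ?; case: (leqP b k) => ?;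
  try (by exfalso; lia); by apply/eqP/eqP; lia.
Qed.

Lemma sum_act (aT : finGroupType) (T : finType) (to : {action aT &-> T})
    (A : {group aT}) x (V : nmodType) (f : T -> V) :
  \sum_(a in A) f (to x a) = (\sum_(y in orbit to A x) f y) *+ #|('C_A[x | to])%g|.
Proof.
rewrite (partition_big (to x) (mem (orbit to A x))) => [|a Aa]; last exact: mem_orbit.
rewrite -sumrMnl; apply: eq_bigr => _ /orbitP[a Aa <-].
rewrite (eq_bigr (fun=> f (to x a))) => [|b /andP[_ /eqP->] //].
(* The elements taking [x] to a given point of its orbit form a coset of the stabilizer. *)
rewrite sumr_const -(card_rcoset _ a) -amove_act ?subsetT //.
by congr (_ *+ _); apply: eq_card => b; rewrite !inE.
Qed.

(** * Orbits on the ideal *)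

Section Rooks.
Variables (F : finFieldType) (n : nat) (I : segments n).
Local Notation gl := (gla F I).
Local Notation M := 'M[F]_n.
Implicit Types (A B X Y : gl) (D : {set 'I_n * 'I_n}).

(** * The product of [gla] as a sum over arcs *)

Definition cyc_dist (i j : 'I_n) : nat := circ_dist (nseg I) (blk I i) (blk I j).

Definition on_arc (i k j : 'I_n) : bool :=
  (cyc_dist i k + cyc_dist k j == cyc_dist i j)%N.

(** If the block of [i] does not come after that of [j], the arc is the interval between them and
    the sum is the product of the upper parts. Otherwise the arc wraps around: blocks from that of
    [i] on pair an upper entry of [A] with a lower entry of [B], blocks up to that of [j] a lower
    entry of [A] with an upper entry of [B]. *)
Lemma gla_mulE A B i j :
  (A * B) i j = \sum_(k | on_arc i k j) A i k * B k j.
Proof.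
rewrite glaM [RHS]big_mkcond !mxE.
have lt_i := ltn_ord (blk I i); have lt_j := ltn_ord (blk I j).
case: ltnP => le_ij; rewrite ?addr0 ?mxE -?big_split -?big_split /=.
  apply: eq_bigr => k _; have lt_k := ltn_ord (blk I k).
  rewrite !mxE /on_arc /cyc_dist /circ_dist.
  by do !case: leqP => ?; case: eqP => ?; rewrite ?mulr0 ?mul0r ?addr0 ?add0r //;
    exfalso; lia.
apply: eq_bigr => k _; have lt_k := ltn_ord (blk I k).
rewrite !mxE /on_arc /cyc_dist /circ_dist.
by do !case: leqP => ?; case: eqP => ?; rewrite ?mulr0 ?mul0r ?addr0 ?add0r //;
  exfalso; lia.
Qed.

Lemma cyc_distnn i : cyc_dist i i = 0%N.
Proof. by rewrite /cyc_dist /circ_dist leqnn subnn. Qed.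

Lemma cyc_dist_inj c i j :
  (cyc_dist c i == cyc_dist c j) = (blk I i == blk I j).
Proof. exact: circ_dist_inj. Qed.

Lemma cyc_dist_root i j : (cyc_dist i j != 0)%N = (blk I i != blk I j).
Proof. by rewrite -(cyc_distnn i) cyc_dist_inj eq_sym. Qed.

Lemma on_arc_row i k j : on_arc i k j = (cyc_dist i k <= cyc_dist i j)%N.
Proof. exact: circ_dist_addl. Qed.

Lemma on_arc_col i k j : on_arc i k j = (cyc_dist k j <= cyc_dist i j)%N.
Proof. exact: circ_dist_addr. Qed.

Lemma on_arc_pos c i k j : (cyc_dist c i <= cyc_dist c j)%N ->
  on_arc i k j = (cyc_dist c i <= cyc_dist c k <= cyc_dist c j)%N.
Proof. exact: circ_dist_between. Qed.

(** * Windows, their ranks and the counts of rooks *)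

Definition window c a b A : M :=
  \matrix_(i, j) (if [&& a <= cyc_dist c i, cyc_dist c i <= cyc_dist c j
                       & cyc_dist c j <= b]%N then A i j else 0).

(* The condition in window defines a convex part of the cyclically ordered
   blocks cut open before the block of c. *)
Lemma window_mul c a b A B :
  window c a b (A * B) = window c a b A *m window c a b B.
Proof.
apply/matrixP=> i j; rewrite [LHS]mxE gla_mulE [RHS]mxE.
case: ifP => [/and3P[le_ai le_ij le_jb] | out].
  rewrite big_mkcond; apply: eq_bigr => k _.
  rewrite !mxE (on_arc_pos _ le_ij) le_ai le_jb andbT /=.
  by do 2![case: leqP => ? /=]; rewrite ?mul0r ?mulr0 ?andbF //;
     do ?case: ifP; rewrite ?mul0r ?mulr0 //; lia.
rewrite big1 // => k _; rewrite !mxE.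
by do 2![case: ifP => ?]; rewrite ?mul0r ?mulr0 //; lia.
Qed.

Lemma X_coef D i j : (X_ F I D : M) i j = ((i, j) \in D)%:R.
Proof.
rewrite /X_ summxE; have [Dij | nDij] := boolP ((i, j) \in D).
  rewrite (bigD1 (i, j)) //= mxE !eqxx big1 ?addr0 // => -[a b] /= /andP[_].
  by rewrite mxE xpair_eqE negb_and (eq_sym i) (eq_sym j) -negb_and => /negPf->.
rewrite big1 // => -[a b] /= Dab; rewrite mxE.
by case: eqP => //= ia; case: eqP => //= jb; move: nDij; rewrite ia jb Dab.
Qed.

Lemma window_X c a b D : window c a b (X_ F I D) = X_ F I [set r in D |
  [&& a <= cyc_dist c r.1, cyc_dist c r.1 <= cyc_dist c r.2 & cyc_dist c r.2 <= b]%N].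
Proof.
apply/matrixP=> i j; rewrite X_coef !mxE X_coef inE /=.
by case: ifP; rewrite ?andbT ?andbF.
Qed.

Definition nonattacking D :=
  {in D &, forall r s, (r.1 == s.1) || (r.2 == s.2) -> r = s}.

Lemma rook_placementP D :
  reflect ({in D, forall r, is_root I r} /\ nonattacking D) (rook_placement I D).
Proof.
apply: (iffP andP) => [[/forall_inP rootD /forall_inP attD] | [rootD attD]].
  split=> // r s Dr Ds att; apply/eqP.
  by move/forall_inP: (attD r Dr) => /(_ s Ds) /implyP/(_ att).
split; apply/forall_inP=> // r Dr; apply/forall_inP=> s Ds.
by apply/implyP=> att; apply/eqP/attD.
Qed.

(** The factorization [A *m B] through a space with one coordinate per rook bounds the rank from
    above. As no two rooks share a row or a column, the transposes of [A] and [B] are one-sided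
    inverses, which gives the lower bound. *)
Lemma rank_X D : nonattacking D -> \rank (X_ F I D : M) = #|D|.
Proof.
move=> attD.
pose A : 'M[F]_(n, #|D|) := \matrix_(i, k) ((enum_val k).1 == i)%:R.
pose B : 'M[F]_(#|D|, n) := \matrix_(k, j) ((enum_val k).2 == j)%:R.
have XAB : X_ F I D = A *m B :> M.
  apply/matrixP=> i j; rewrite /X_ summxE big_enum_val mxE.
  apply: eq_bigr => k _; rewrite !mxE -natrM mulnb.
  by rewrite (eq_sym i) (eq_sym j).
have AA : A^T *m A = 1%:M.
  apply/matrixP=> k l; rewrite !mxE (bigD1 (enum_val k).1) //= !mxE eqxx mul1r.
  rewrite big1 ?addr0 => [|i /negPf ki]; last by rewrite !mxE eq_sym ki mul0r.
  congr ((nat_of_bool _)%:R); apply/eqP/eqP=> [/esym e | -> //]; apply: enum_val_inj.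
  by apply: attD; rewrite ?enum_valP // e eqxx.
have BB : B *m B^T = 1%:M.
  apply/matrixP=> k l; rewrite !mxE (bigD1 (enum_val k).2) //= !mxE eqxx mul1r.
  rewrite big1 ?addr0 => [|i /negPf ki]; last by rewrite !mxE eq_sym ki mul0r.
  congr ((nat_of_bool _)%:R); apply/eqP/eqP=> [/esym e | -> //]; apply: enum_val_inj.
  by apply: attD; rewrite ?enum_valP // e eqxx orbT.
apply/eqP; rewrite eqn_leq {1}XAB mulmx_max_rank /=.
have -> : #|D| = \rank (A^T *m (X_ F I D : M) *m B^T).
  by rewrite XAB mulmxA AA mul1mx BB mxrank1.
by apply: leq_trans (mxrankM_maxl _ _) _; apply: mxrankM_maxr.
Qed.

Definition window_count c a b D : nat :=
  \sum_(r in D) [&& a <= cyc_dist c r.1, cyc_dist c r.1 <= cyc_dist c r.2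
                  & cyc_dist c r.2 <= b]%N.

Lemma rank_window c a b D : nonattacking D ->
  \rank (window c a b (X_ F I D)) = window_count c a b D.
Proof.
move=> attD; rewrite window_X rank_X => [|r s]; last first.
  by rewrite !inE => /andP[Dr _] /andP[Ds _]; apply: attD.
rewrite -sum1_card /window_count [LHS]big_mkcond [RHS]big_mkcond /=.
by apply: eq_bigr => r _; rewrite inE; case: (r \in D) => //=; case: ifP.
Qed.

(** Windows are multiplicative, and multiplication cannot raise a rank. *)
Lemma window_count_le c a b D D' A B : nonattacking D -> nonattacking D' ->
  X_ F I D' = A * X_ F I D * B -> (window_count c a b D' <= window_count c a b D)%N.
Proof.
move=> attD attD' eqX; rewrite -!rank_window // eqX !window_mul.
by apply: leq_trans (mxrankM_maxl _ _) _; apply: mxrankM_maxr.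
Qed.

Definition block_count (k l : 'I_(nseg I)) D : nat :=
  \sum_(r in D) ((blk I r.1, blk I r.2) == (k, l)).

(* Inclusion-exclusion in the windows starting at the block of i. *)
Lemma block_countE i j D : {in D, forall r, is_root I r} -> blk I i != blk I j ->
  (window_count i 0 (cyc_dist i j) D + window_count i 1 (cyc_dist i j).-1 D
   = window_count i 1 (cyc_dist i j) D + window_count i 0 (cyc_dist i j).-1 D
     + block_count (blk I i) (blk I j) D)%N.
Proof.
move=> rootD; rewrite -cyc_dist_root /window_count /block_count => ij.
rewrite -!big_split; apply: eq_bigr => r Dr /=.
rewrite xpair_eqE -(cyc_dist_inj i r.2) -(cyc_dist_inj i r.1) cyc_distnn.
apply: window_inclusion_exclusion => //.
by have := rootD r Dr; rewrite /is_root -(cyc_dist_inj i).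
Qed.

(** Inverting [g] and [h] gives the inequality of window counts in both directions;
    inclusion-exclusion then recovers the block counts. Diagonal blocks contain no roots. *)
Lemma block_count_eq D D' (g h : {unit gl}) :
    rook_placement I D -> rook_placement I D' ->
  X_ F I D' = val g * X_ F I D * val h ->
  forall k l, block_count k l D' = block_count k l D.
Proof.
move=> /rook_placementP[rootD attD] /rook_placementP[rootD' attD'] eqX k l.
have eqX' : X_ F I D = val g^-1%g * X_ F I D' * val h^-1%g.
  rewrite eqX !mulrA -FinRing.val_unitM mulVg mul1r -mulrA.
  by rewrite -FinRing.val_unitM mulgV mulr1.
have wc c a b : window_count c a b D' = window_count c a b D.
  by apply/eqP; rewrite eqn_leq (window_count_le _ _ _ _ _ eqX)
     ?(window_count_le _ _ _ _ _ eqX').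
have [i <-] := blk_surj k; have [j <-] := blk_surj l.
have [eij | ij] := eqVneq (blk I i) (blk I j); last first.
  by have := block_countE rootD ij; have := block_countE rootD' ij; rewrite !wc; lia.
have zero (E : {set 'I_n * 'I_n}) : {in E, forall r, is_root I r} ->
    block_count (blk I i) (blk I j) E = 0%N.
  move=> rootE; apply: big1 => r Er; apply/eqP; rewrite eqb0 xpair_eqE -eij.
  by apply/andP=> -[/eqP e1 /eqP e2]; have := rootE r Er; rewrite /is_root e1 e2 eqxx.
by rewrite !zero.
Qed.

Lemma mem_WL (w : {perm 'I_n}) :
  (w \in WL I) = [forall i, blk I (w i) == blk I i].
Proof. by rewrite inE. Qed.

(** Equal counts match the rooks of [D] with those of [D'] in the same pair of blocks. Distinct
    rooks have distinct rows, so the matching of rows extends to a permutation in [WL I]; likewise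
    for columns. *)
Lemma block_count_WL_orbit D D' : nonattacking D -> nonattacking D' ->
  (forall k l, block_count k l D' = block_count k l D) -> D' \in WL_orbit I D.
Proof.
move=> attD attD' eq_count.
pose key (r : 'I_n * 'I_n) := (blk I r.1, blk I r.2).
have cardE (E : {set 'I_n * 'I_n}) : #|E| = (\sum_t block_count t.1 t.2 E)%N.
  rewrite /block_count exchange_big -sum1_card; apply: eq_bigr => r _ /=.
  rewrite (bigD1 (key r)) //= eqxx big1 // => -[k l] /negPf.
  by rewrite eq_sym => ->.
have [||w bij_w keyw] := @bij_of_fibers _ #|D| #|D'|
    (fun x => key (enum_val x)) (fun x => key (enum_val x)).
- by rewrite !cardE; apply: eq_bigr => t _; rewrite eq_count.
- case=> k l; have := eq_count k l; rewrite /block_count.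
  by rewrite [LHS]big_enum_val [RHS]big_enum_val /= => ->.
have inj1 (E : {set 'I_n * 'I_n}) : nonattacking E ->
    injective (fun x : 'I_#|E| => (enum_val x).1).
  move=> attE x y /= e; apply: enum_val_inj.
  by apply: attE; rewrite ?enum_valP // e eqxx.
have inj2 (E : {set 'I_n * 'I_n}) : nonattacking E ->
    injective (fun x : 'I_#|E| => (enum_val x).2).
  move=> attE x y /= e; apply: enum_val_inj.
  by apply: attE; rewrite ?enum_valP // e eqxx orbT.
have inj_w := bij_inj bij_w.
have [||x|w1 bw1 w1E] := @extend_to_perm _ n #|D| (blk I)
    (fun x => (enum_val x).1) (fun x => (enum_val (w x)).1).
- exact: inj1.
- exact: inj_comp (inj1 _ attD') inj_w.
- by have [->] := keyw x.
have [||x|w2 bw2 w2E] := @extend_to_perm _ n #|D| (blk I)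
    (fun x => (enum_val x).2) (fun x => (enum_val (w x)).2).
- exact: inj2.
- exact: inj_comp (inj2 _ attD') inj_w.
- by have [_ ->] := keyw x.
(* [WL_act] applies the inverse of its second permutation to the columns. *)
apply/imset2P; exists w1 w2^-1%g.
- by rewrite mem_WL; apply/forallP=> i; rewrite bw1.
- by rewrite mem_WL; apply/forallP=> i; rewrite -{2}[i](permKV w2) bw2.
have [w' _ w'K] := bij_w.
apply/setP=> r; apply/idP/imsetP => [D'r | [s Ds ->]].
  exists (enum_val (w' (enum_rank_in D'r r))); first exact: enum_valP.
  by rewrite invgK w1E w2E w'K enum_rankK_in // -surjective_pairing.
rewrite invgK -(enum_rankK_in Ds Ds) w1E w2E -surjective_pairing.
exact: enum_valP.
Qed.

(** * Units of [gla] *)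

Lemma unit_of_inverse (A B : gl) : A * B = 1 -> B * A = 1 ->
  exists g : {unit gl}, val g = A.
Proof.
move=> AB BA; have uA : A \is a GRing.unit by apply/unitrP; exists B.
by exists (FinRing.unit gl uA).
Qed.

Lemma unit_1subr (N : gl) : N * N = 0 -> exists g : {unit gl}, val g = 1 - N.
Proof.
move=> NN; apply: (@unit_of_inverse _ (1 + N)).
  by rewrite mulrDr mulr1 mulrBl mul1r NN subr0 subrK.
by rewrite mulrDl mul1r mulrBr mulr1 NN subr0 subrK.
Qed.

Definition block_diagonal (T : M) := forall i j, blk I i != blk I j -> T i j = 0.

(** A nonzero [T i k] has [k] in the block of [i], and that block lies on every arc starting at [i];
    so no term of the ordinary product is lost. *)
Lemma block_diagonal_mull (T A : gl) : block_diagonal T -> T * A = T *m A :> M.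
Proof.
move=> dT; apply/matrixP=> i j; rewrite gla_mulE mxE big_mkcond.
apply: eq_bigr => k _; rewrite on_arc_row.
have [ik | /dT->] := eqVneq (blk I i) (blk I k); last by rewrite mul0r if_same.
suff -> : cyc_dist i k = 0%N by [].
by apply/eqP; rewrite -(cyc_distnn i) cyc_dist_inj ik.
Qed.

Lemma block_diagonal_mulr (T A : gl) : block_diagonal T -> A * T = A *m T :> M.
Proof.
move=> dT; apply/matrixP=> i j; rewrite gla_mulE mxE big_mkcond.
apply: eq_bigr => k _; rewrite on_arc_col.
have [kj | /dT->] := eqVneq (blk I k) (blk I j); last by rewrite mulr0 if_same.
suff -> : cyc_dist k j = 0%N by [].
by apply/eqP; rewrite -(cyc_distnn k) cyc_dist_inj kj.
Qed.

Lemma block_diagonal_unit (T T' : gl) : block_diagonal T ->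
  T *m T' = 1%:M :> M -> T' *m T = 1%:M :> M -> exists g : {unit gl}, val g = T.
Proof.
move=> dT TT' T'T; apply: (@unit_of_inverse _ T').
  by rewrite [LHS]block_diagonal_mull.
by rewrite [LHS]block_diagonal_mulr.
Qed.

Lemma perm_mx_block_diagonal w : w \in WL I -> block_diagonal (perm_mx w).
Proof.
rewrite mem_WL => /forallP wI i j ij; rewrite !mxE.
case: (w i =P j) ij => [<- | _ _]; last by rewrite mulr0n.
by rewrite (eqP (wI i)) eqxx.
Qed.

Lemma perm_mx_unit w : w \in WL I -> exists g : {unit gl}, val g = perm_mx w.
Proof.
move=> wI; apply: (@block_diagonal_unit _ (perm_mx w^-1%g)).
- exact: perm_mx_block_diagonal.
- by rewrite -perm_mxM mulgV perm_mx1.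
- by rewrite -perm_mxM mulVg perm_mx1.
Qed.

Lemma WL_inv w : w \in WL I -> w^-1%g \in WL I.
Proof.
rewrite !mem_WL => /forallP wI; apply/forallP=> i.
by rewrite -{2}[i](permKV w) eq_sym wI.
Qed.

Lemma X_WL_orbit D D' : D' \in WL_orbit I D ->
  exists g h : {unit gl}, X_ F I D' = val g * X_ F I D * val h.
Proof.
case/imset2P=> w1 w2 /WL_inv w1I /WL_inv w2I ->.
have [g gE] := perm_mx_unit w1I; have [h hE] := perm_mx_unit w2I.
exists g, h; rewrite gE hE.
have dh := perm_mx_block_diagonal w2I; have dg := perm_mx_block_diagonal w1I.
rewrite [RHS](block_diagonal_mulr _ dh) [_ * _](block_diagonal_mull _ dg).
rewrite -row_permE -col_permE; apply/matrixP=> i j; rewrite !mxE !X_coef.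
congr (nat_of_bool _)%:R; apply/imsetP/idP=> [[[a b] Dab [-> ->]] | Dij].
  by rewrite permK permKV.
by exists (w1^-1%g i, w2 j); rewrite //= permK permKV.
Qed.

(** * Elimination with pivots of minimal degree *)

Definition isolated (A : M) (r : 'I_n * 'I_n) :=
  [/\ A r.1 r.2 != 0, forall j, j != r.2 -> A r.1 j = 0
    & forall i, i != r.1 -> A i r.2 = 0].

(** The unit [1 - N], with [N] of square zero, subtracts multiples of row [i]. The product keeps
    [N a i * A i b] only if [i] is on the arc from [a] to [b]; minimality of the pivot in its column
    ensures this at [b = j] for every entry to be cancelled. The second clause protects the pivots
    isolated before. *)
Lemma clear_column A i j : A i j != 0 ->
    (forall a, A a j != 0 -> (cyc_dist i j <= cyc_dist a j)%N) ->
  exists g : {unit gl}, [/\ forall b, (val g * A) i b = A i b,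
    forall a b, A a j = 0 \/ A i b = 0 -> (val g * A) a b = A a b
  & forall a, a != i -> (val g * A) a j = 0].
Proof.
move=> Aij min_ij.
pose N : gl := \matrix_(a, b) (if (b == i) && (a != i) then A a j / A i j else 0).
have NE a b : (N * A) a b =
    (if on_arc a i b && (a != i) then A a j / A i j * A i b else 0).
  rewrite gla_mulE big_mkcond (bigD1 i) //= big1 ?addr0 => [|k /negPf ki].
    by rewrite mxE eqxx /=; case: (a == i); case: on_arc; rewrite //= mul0r.
  by rewrite mxE ki mul0r if_same.
have NN : N * N = 0.
  apply/matrixP=> a b; rewrite gla_mulE [RHS]mxE big1 // => k _.
  by rewrite !mxE; case: (k == i); rewrite /= ?mul0r ?andbF ?mulr0.
have [g gE] := unit_1subr NN.
have gA a b : (val g * A) a b = A a b - (N * A) a b.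
  by rewrite gE mulrBl mul1r !mxE.
exists g; split=> [b|a b A0|a ai]; rewrite gA NE.
- by rewrite eqxx andbF subr0.
- by case: ifP; rewrite ?subr0 //; case: A0 => ->; rewrite ?mulr0 ?mul0r subr0.
rewrite ai andbT on_arc_col; have [-> | /min_ij->] := eqVneq (A a j) 0.
  by rewrite !mul0r if_same subr0.
by rewrite divfK // subrr.
Qed.

Lemma clear_row A i j : A i j != 0 ->
    (forall b, A i b != 0 -> (cyc_dist i j <= cyc_dist i b)%N) ->
  exists h : {unit gl}, [/\ forall a, (A * val h) a j = A a j,
    forall a b, A i b = 0 \/ A a j = 0 -> (A * val h) a b = A a b
  & forall b, b != j -> (A * val h) i b = 0].
Proof.
move=> Aij min_ij.
pose N : gl := \matrix_(a, b) (if (a == j) && (b != j) then A i b / A i j else 0).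
have NE a b : (A * N) a b =
    (if on_arc a j b && (b != j) then A a j * (A i b / A i j) else 0).
  rewrite gla_mulE big_mkcond (bigD1 j) //= big1 ?addr0 => [|k /negPf kj].
    by rewrite mxE eqxx /=; case: (b == j); case: on_arc; rewrite //= mulr0.
  by rewrite mxE kj mulr0 if_same.
have NN : N * N = 0.
  apply/matrixP=> a b; rewrite gla_mulE [RHS]mxE big1 // => k _.
  by rewrite !mxE; case: (k == j); rewrite /= ?mulr0 ?andbF ?mul0r.
have [h hE] := unit_1subr NN.
have hA a b : (A * val h) a b = A a b - (A * N) a b.
  by rewrite hE mulrBr mulr1 !mxE.
exists h; split=> [a|a b A0|b bj]; rewrite hA NE.
- by rewrite eqxx andbF subr0.
- by case: ifP; rewrite ?subr0 //; case: A0 => ->; rewrite ?mul0r ?mulr0 subr0.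
rewrite bj andbT on_arc_row; have [-> | /min_ij->] := eqVneq (A i b) 0.
  by rewrite mul0r mulr0 if_same subr0.
by rewrite mulrC divfK // subrr.
Qed.

Lemma isolated_eq A (r s : 'I_n * 'I_n) : isolated A r -> A s.1 s.2 != 0 ->
  (r.1 == s.1) || (r.2 == s.2) -> r = s.
Proof.
case: r s => [i j] [a b] [/= _ row0 col0] Aab /orP[]/eqP e; rewrite -e in Aab *.
  by have [->//|/row0] := eqVneq b j; move/eqP; rewrite (negPf Aab).
by have [->//|/col0] := eqVneq a i; move/eqP; rewrite (negPf Aab).
Qed.

Lemma isolate_pivot A D : (forall r, r \in D -> isolated A r) ->
    (exists2 r, r \notin D & A r.1 r.2 != 0) ->
  exists g h : {unit gl}, exists2 r, r \notin D &
    forall s, s \in r |: D -> isolated (val g * A * val h) s.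
Proof.
move=> isoD [r0 nDr0 Ar0].
pose P r := (r \notin D) && (A r.1 r.2 != 0).
have Pr0 : P r0 by apply/andP.
case: (arg_minnP (fun r => cyc_dist r.1 r.2) Pr0) => -[i j] /andP[/= nDij Aij] min_ij.
(* A nonzero entry at a position of [D] is isolated, so it cannot share a row or column with the
   pivot. Minimality outside [D] therefore covers the whole row and column of the pivot. *)
have nz a b : A a b != 0 -> (a == i) || (b == j) -> (cyc_dist i j <= cyc_dist a b)%N.
  move=> Aab ab; apply: (min_ij (a, b)); rewrite /P Aab andbT.
  apply/negP=> Dab; case/negP: nDij; suff -> : (i, j) = (a, b) by [].
  by apply/esym/(isolated_eq (isoD _ Dab)).
have [g [gi gA gj]] : exists g : {unit gl}, [/\ forall b, (val g * A) i b = A i b,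
    forall a b, A a j = 0 \/ A i b = 0 -> (val g * A) a b = A a b
  & forall a, a != i -> (val g * A) a j = 0].
  by apply: clear_column => // a Aaj; rewrite nz // eqxx orbT.
pose B : gl := val g * A.
have [h [hj hB hi]] : exists h : {unit gl}, [/\ forall a, (B * val h) a j = B a j,
    forall a b, B i b = 0 \/ B a j = 0 -> (B * val h) a b = B a b
  & forall b, b != j -> (B * val h) i b = 0].
  by apply: clear_row => [|b]; rewrite gi // => Aib; rewrite nz // eqxx.
exists g, h; exists (i, j) => // -[a b]; rewrite in_setU1 => /predU1P[[-> ->]|Dab].
  by split=> //= [|k ki]; rewrite hj ?gi ?gj.
have [/= Aab row0 col0] := isoD _ Dab.
have bj : j != b.
  apply: contraNneq nDij => jb; have -> // : (i, j) = (a, b).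
  by apply/esym/(isolated_eq (isoD _ Dab)); rewrite //= jb eqxx orbT.
have ai : i != a.
  apply: contraNneq nDij => ia; have -> // : (i, j) = (a, b).
  by apply/esym/(isolated_eq (isoD _ Dab)); rewrite //= ia eqxx.
(* For an earlier pivot [(a, b)], row [a] vanishes in column [j] and column [b] vanishes in row [i],
   so both clearings leave them intact. *)
have rowB k : B a k = A a k by rewrite /B gA //; left; apply: row0.
have colB k : B k b = A k b by rewrite /B gA //; right; apply: col0.
have rowC k : (B * val h) a k = A a k.
  by rewrite hB ?rowB //; right; rewrite row0.
have colC k : (B * val h) k b = A k b.
  by rewrite hB ?colB //; left; rewrite col0.
by split=> /= [|k kb|k ka]; rewrite ?rowC ?colC; [|exact: row0|exact: col0].
Qed.

Lemma reduce_to_isolated A : exists g h : {unit gl}, exists D : {set 'I_n * 'I_n},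
  [/\ forall r, r \in D -> isolated (val g * A * val h) r
    & forall r, r \notin D -> (val g * A * val h) r.1 r.2 = 0].
Proof.
(* Induction on the number of positions outside [D], the set of pivots isolated so far. *)
suff reduce m D : (#|~: D| < m)%N ->
    (exists g h : {unit gl}, forall r, r \in D -> isolated (val g * A * val h) r) ->
    exists g h : {unit gl}, exists E : {set 'I_n * 'I_n},
  [/\ forall r, r \in E -> isolated (val g * A * val h) r
    & forall r, r \notin E -> (val g * A * val h) r.1 r.2 = 0].
  by apply: (reduce _ set0 (ltnSn _)); exists 1%g, 1%g => r; rewrite inE.
elim: m => // m IHm in D *; rewrite ltnS => leD [g [h isoD]].
have [/existsP[r /andP[nDr Ar]] | noA] := boolP
    [exists r, (r \notin D) && ((val g * A * val h) r.1 r.2 != 0)]; last first.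
  exists g, h, D; split=> // r nDr; apply/eqP; apply: contraNT noA => Ar.
  by apply/existsP; exists r; rewrite nDr.
have [|g' [h' [s nDs isoD']]] := isolate_pivot isoD; first by exists r.
apply: (IHm (s |: D)).
  apply: leq_trans leD; apply: proper_card; rewrite properC.
  by rewrite properUr // sub1set.
exists (g' * g)%g, (h * h')%g => t Dt.
by rewrite !FinRing.val_unitM !mulrA; have := isoD' t Dt; rewrite !mulrA.
Qed.

Lemma exists_rook A : in_ua A ->
  exists g h : {unit gl}, exists2 D, rook_placement I D & A = val g * X_ F I D * val h.
Proof.
move=> uA; have [g [h [D [isoD D0]]]] := reduce_to_isolated A.
set B := val g * A * val h in isoD D0.
have uB : in_ua B by rewrite in_uaMr ?in_uaMl.
(* A row of [B] has at most one nonzero entry, so its sum is that entry. Zero rows get 1 to make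
   [diag_mx t] invertible. *)
pose t : 'rV[F]_n := \row_i (if \sum_j B i j == 0 then 1 else \sum_j B i j).
have t0 i : t 0 i != 0 by rewrite mxE; case: ifP => [_|/negbT//]; rewrite oner_eq0.
have diag_bd (v : 'rV[F]_n) : block_diagonal (diag_mx v).
  move=> i j ij; rewrite mxE; case: (i =P j) ij => [-> | _ _]; first by rewrite eqxx.
  by rewrite mulr0n.
have [d dE] : exists d : {unit gl}, val d = diag_mx t.
  apply: (@block_diagonal_unit _ (diag_mx (\row_i (t 0 i)^-1))) => //;
    rewrite mulmx_diag -[RHS]diag_const_mx; congr diag_mx; apply/rowP=> i.
    by rewrite [LHS]mxE [X in _ * X]mxE [RHS]mxE divff.
  by rewrite [LHS]mxE [X in X * _]mxE [RHS]mxE mulVf.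
have BE : B = val d * X_ F I D.
  rewrite dE [RHS]block_diagonal_mull //; apply/matrixP=> i j.
  rewrite mul_diag_mx [RHS]mxE X_coef; have [Dij | /D0] := boolP ((i, j) \in D); last first.
    by rewrite mulr0.
  have [/= Bij row0 _] := isoD _ Dij.
  rewrite mulr1 [RHS]mxE (bigD1 j) //= big1 ?addr0 => [|k /row0//].
  by rewrite (negPf Bij).
exists (g^-1 * d)%g, h^-1%g; exists D; last first.
  rewrite FinRing.val_unitM -[_ * _ * X_ _ _ _]mulrA -BE /B !mulrA.
  rewrite -FinRing.val_unitM mulVg mul1r -mulrA -FinRing.val_unitM mulgV.
  by rewrite mulr1.
apply/rook_placementP; split=> [r Dr | r s Dr Ds rs].
  have [Br _ _] := isoD r Dr; apply: contraNneq Br => e.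
  by apply/eqP/(in_uaP _ uB).
by apply: isolated_eq rs; [apply: isoD | have [] := isoD s Ds].
Qed.

Lemma rook_unique D D' (g h : {unit gl}) :
    rook_placement I D -> rook_placement I D' ->
  X_ F I D' = val g * X_ F I D * val h -> D' \in WL_orbit I D.
Proof.
move=> rD rD' eqX; have cnt := block_count_eq rD rD' eqX.
have [_ attD] := rook_placementP _ rD; have [_ attD'] := rook_placementP _ rD'.
exact: block_count_WL_orbit.
Qed.

End Rooks.

(** * The dual of the ideal *)

Section Orbits.
Variables (F : finFieldType) (n : nat) (I : segments n).
Local Notation gl := (gla F I).
Local Notation GLa := {unit gl}.
Local Notation U := (Ua F I).
Local Notation M := 'M[F]_n.
Implicit Types (A X Y Z : gl) (D : {set 'I_n * 'I_n}) (H : {group GLa}).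

(** The left factor is inverted because an [action] is a right action. *)
Definition biact A (a : GLa * GLa) : gl := val a.1^-1%g * A * val a.2.

Lemma biact1l A (h : GLa) : biact A (1%g, h) = A * val h.
Proof. by rewrite /biact invg1 mul1r. Qed.

Fact biact_is_action : is_action setT biact.
Proof.
apply: is_total_action => [A | A a b]; rewrite /biact.
  by rewrite invg1 mul1r mulr1.
have -> : val (a * b).1^-1%g = val b.1^-1%g * val a.1^-1%g.
  by rewrite -FinRing.val_unitM -invMg.
by rewrite (FinRing.val_unitM a.2) !mulrA.
Qed.
Canonical biact_action := Action biact_is_action.

Lemma in_ua_biact A a : in_ua (biact A a) = in_ua A.
Proof.
have imp B b : in_ua B -> in_ua (biact B b).
  by move=> uB; rewrite /biact in_uaMr // in_uaMl.
apply/idP/idP=> [uAa|]; last exact: imp.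
have := imp _ a^-1%g uAa.
by rewrite -[biact (biact A a) _]/(biact_action (biact_action A a) _) actK.
Qed.

Lemma in_ua_orbit (S : {group GLa * GLa}) Y Z :
  in_ua Y -> Z \in orbit biact_action S Y -> in_ua Z.
Proof. by move=> uY /orbitP[a _ <-]; rewrite [in_ua _]in_ua_biact. Qed.

(** * The invariant trace form *)

Definition trform (Y X : gl) : F := \tr ((Y : M) *m (X : M)).

Lemma trformC Y X : trform Y X = trform X Y.
Proof. exact: mxtrace_mulC. Qed.

Lemma trformDr Y X X' : trform Y (X + X') = trform Y X + trform Y X'.
Proof. by rewrite /trform mulmxDr mxtraceD. Qed.

Lemma trform0r Y : trform Y 0 = 0.
Proof. by rewrite /trform mulmx0 mxtrace0. Qed.

Lemma trformBl Y Z X : trform (Y - Z) X = trform Y X - trform Z X.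
Proof.
apply: (addIr (trform Z X)); rewrite subrK !(trformC _ X) -trformDr.
by rewrite subrK.
Qed.

(** Both sides sum [A i k * Y k j * X j i], the left over [k] on the arc from [i] to [j], the right
    over [i] on the arc from [j] to [k]. These conditions agree by rotation, except when [j] shares
    its block with [k] or [i], where [Y k j] or [X j i] is zero. *)
Lemma trformMl A Y X : in_ua Y -> in_ua X -> trform (A * Y) X = trform Y (X * A).
Proof.
move=> /in_uaP uY /in_uaP uX; rewrite /trform.
transitivity (\sum_i \sum_k \sum_j (if on_arc I i k j then A i k * Y k j * X j i else 0)).
  apply: eq_bigr => i _; rewrite mxE exchange_big; apply: eq_bigr => j _ /=.
  rewrite gla_mulE mulr_suml big_mkcond; apply: eq_bigr => k _.
  by case: ifP.
rewrite exchange_big; apply: eq_bigr => k _; rewrite mxE exchange_big.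
apply: eq_bigr => j _ /=; rewrite gla_mulE mulr_sumr [RHS]big_mkcond.
apply: eq_bigr => i _.
have [kj | kj] := eqVneq (blk I k) (blk I j).
  by rewrite uY // !mul0r mulr0 !mul0r !if_same.
have [ji | ji] := eqVneq (blk I j) (blk I i).
  by rewrite uX // !mul0r !mulr0 !if_same.
by rewrite /on_arc /cyc_dist circ_dist_rotate //; case: ifP => // _;
   rewrite -mulrA mulrC -mulrA.
Qed.

Lemma trformMr A Y X : in_ua Y -> in_ua X -> trform (Y * A) X = trform Y (A * X).
Proof. by move=> uY uX; rewrite trformC -trformMl // trformC. Qed.

Lemma trform_nondeg Y : in_ua Y -> Y != 0 -> exists2 X, in_ua X & trform Y X = 1.
Proof.
move=> /in_uaP uY nzY.
have /existsP[i /existsP[j Yij]] : [exists i, exists j, (Y : M) i j != 0].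
  apply: contraNT nzY; rewrite negb_exists => /forallP Y0.
  apply/eqP/matrixP=> i j; have := Y0 i; rewrite negb_exists => /forallP/(_ j).
  by rewrite negbK mxE => /eqP.
exists (((Y : M) i j)^-1 *: delta_mx j i : M).
  apply/in_uaP=> a b ab; rewrite !mxE; case: eqP => [aj|_]; last by rewrite mulr0.
  case: eqP => [bi|_]; last by rewrite mulr0.
  by move: Yij; rewrite -bi -aj uY ?eqxx.
rewrite /trform -scalemxAr mxtraceZ /mxtrace (bigD1 i) //= big1 ?addr0 => [|k ki].
  rewrite mxE (bigD1 j) //= big1 ?addr0 => [|k kj].
    by rewrite mxE !eqxx mulr1 mulVf.
  by rewrite mxE (negPf kj) mulr0.
by rewrite mxE big1 // => l _; rewrite mxE (negPf ki) andbF mulr0.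
Qed.

Definition dual_of Y : {ffun ua F I -> F} := [ffun X => trform Y (val X)].

Lemma dual_of_inj Y Z : in_ua Y -> in_ua Z -> dual_of Y = dual_of Z -> Y = Z.
Proof.
move=> uY uZ eqYZ; apply/eqP; rewrite -subr_eq0; apply: contraT => nz.
have uYZ : in_ua (Y - Z).
  apply/in_uaP=> i j ij; rewrite !mxE.
  by rewrite (in_uaP _ uY) // (in_uaP _ uZ) // subrr.
have [X uX] := trform_nondeg uYZ nz; rewrite trformBl.
have := congr1 (fun L : {ffun _ -> _} => L (Sub X uX)) eqYZ.
rewrite !ffunE SubK => ->; rewrite subrr => /eqP.
by rewrite eq_sym oner_eq0.
Qed.

Lemma lact_dual_of (g : GLa) Y : in_ua Y -> Defs.lact g (dual_of Y) = dual_of (val g * Y).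
Proof.
move=> uY; apply/ffunP=> X; rewrite !ffunE /= trformMl //; exact: valP X.
Qed.

Lemma ract_dual_of (g : GLa) Y : in_ua Y -> Defs.ract (dual_of Y) g = dual_of (Y * val g).
Proof.
move=> uY; apply/ffunP=> X; rewrite !ffunE /= trformMr //; exact: valP X.
Qed.

Lemma biorbit_dual_of H Y : in_ua Y ->
  biorbit H (dual_of Y) = dual_of @: orbit biact_action (setX H H) Y.
Proof.
move=> uY; apply/setP=> L; apply/imset2P/imsetP => [[g h Hg Hh ->] | [Z /orbitP[[g h]]]].
  exists (val g * Y * val h).
    apply/orbitP; exists (g^-1, h)%g; first by rewrite inE groupV Hg.
    by rewrite /= /biact invgK.
  by rewrite lact_dual_of // ract_dual_of // in_uaMl.
rewrite inE /= => /andP[Hg Hh] <- ->; exists g^-1%g h; rewrite ?groupV //.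
by rewrite lact_dual_of // ract_dual_of // in_uaMl.
Qed.

Lemma rorbit_dual_of H Y : in_ua Y ->
  rorbit H (dual_of Y) = dual_of @: orbit biact_action (setX [1 GLa] H) Y.
Proof.
move=> uY; apply/setP=> L; apply/imsetP/imsetP => [[h Hh ->] | [Z /orbitP[[g h]]]].
  exists (Y * val h); last by rewrite ract_dual_of.
  apply/orbitP; exists (1, h)%g; first by rewrite !inE eqxx.
  exact: biact1l.
rewrite !inE /= => /andP[/eqP-> Hh] <- ->; exists h => //.
by rewrite ract_dual_of // -biact1l.
Qed.

(** * Transposed rook placements *)

Definition transpose_pl D : {set 'I_n * 'I_n} := [set (r.2, r.1) | r in D].

Lemma transpose_plK : involutive transpose_pl.
Proof.
move=> D; rewrite /transpose_pl -imset_comp -[RHS]imset_id.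
by apply: eq_imset => -[].
Qed.

Lemma mem_transpose_pl D i j : ((i, j) \in transpose_pl D) = ((j, i) \in D).
Proof.
apply/imsetP/idP => [[[a b] Dab [-> ->]] // | Dji].
by exists (j, i).
Qed.

Lemma rook_transpose_pl D : rook_placement I D -> rook_placement I (transpose_pl D).
Proof.
case/rook_placementP=> rootD attD; apply/rook_placementP; split=> [[i j]|[i j] [a b]].
  by rewrite mem_transpose_pl => /rootD; rewrite /is_root eq_sym.
rewrite !mem_transpose_pl => Dji Dba att; have := attD _ _ Dji Dba.
by rewrite orbC => /(_ att)[-> ->].
Qed.

Lemma WL_orbit_transpose_pl D D' : transpose_pl D' \in WL_orbit I (transpose_pl D) ->
  D' \in WL_orbit I D.
Proof.
case/imset2P=> w1 w2 w1I w2I eqD; apply/imset2P.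
exists w2^-1%g w1^-1%g; rewrite ?WL_inv //.
rewrite -[LHS]transpose_plK eqD /WL_act /transpose_pl -!imset_comp.
by apply: eq_imset => -[i j] /=; rewrite invgK.
Qed.

Lemma in_ua_X D : rook_placement I D -> in_ua (X_ F I D).
Proof.
case/rook_placementP=> rootD _; apply/in_uaP=> i j ij.
rewrite X_coef; case: ((i, j) \in D) / boolP => // /rootD.
by rewrite /is_root ij eqxx.
Qed.

Lemma Lambda_dual_of D : Lambda F I D = dual_of (X_ F I (transpose_pl D)).
Proof.
apply/ffunP=> X; rewrite !ffunE /trform /X_ big_imset => [|[a b] [c d] _ _ [-> ->] //].
rewrite /= mulmx_suml raddf_sum; apply: eq_bigr => -[i j] _ /=.
rewrite /mxtrace (bigD1 j) //= big1 ?addr0 => [|k kj].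
  rewrite mxE (bigD1 i) //= big1 ?addr0 => [|k ki].
    by rewrite mxE !eqxx mul1r.
  by rewrite mxE (negPf ki) andbF mul0r.
by rewrite mxE big1 // => l _; rewrite mxE (negPf kj) mul0r.
Qed.

End Orbits.

(** * Characters of biorbits *)

Section BiorbitCharacters.
Variables (F : finFieldType) (n : nat) (I : segments n).
Local Notation gl := (gla F I).
Local Notation GLa := {unit gl}.
Local Notation U := (Ua F I).
Local Notation M := 'M[F]_n.
Implicit Types (A X Y Z : gl) (D : {set 'I_n * 'I_n}) (H : {group GLa}).

Lemma in_uaZ t X : in_ua X -> in_ua (t *: (X : M) : gl).
Proof. by move=> /in_uaP uX; apply/in_uaP=> i j ij; rewrite mxE uX // mulr0. Qed.

Lemma in_ua_addr X Y : in_ua Y -> in_ua (X + Y) = in_ua X.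
Proof.
move=> uY; apply/idP/idP=> [uXY|uX]; last exact: in_uaD.
have -> : X = (X + Y) + (- 1 *: (Y : M) : gl) by rewrite scaleN1r addrK.
by rewrite in_uaD ?in_uaZ.
Qed.

(** As [1 + X] is a unit for every [X] in the ideal, subtracting 1 is a bijection from the group
    onto the ideal. *)
Lemma sum_Ua (V : nmodType) (f : gl -> V) :
  \sum_(u in U) f (val u - 1) = \sum_(X | in_ua X) f X.
Proof.
have inj_h : {in U &, injective (fun u : GLa => val u - 1 : gl)}.
  by move=> u v _ _ /addIr/val_inj.
rewrite -(big_imset f inj_h) /=; apply: eq_bigl => X.
apply/imsetP/idP => [[u uU ->] | uX]; first by rewrite inE in uU.
exists (FinRing.unit gl (unit_1ua uX)); last by rewrite /= addrC addKr.
by rewrite inE /= addrC addKr.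
Qed.

Section Characters.
Variable eps : F -> algC.
Hypothesis epsD : {morph eps : s t / s + t >-> s * t}.
Hypothesis eps_neq0 : forall t, eps t != 0.
Hypothesis eps_nontriv : exists t, eps t != 1.

Lemma eps0 : eps 0 = 1.
Proof.
apply: (mulfI (eps_neq0 0)).
by rewrite -epsD addr0 mulr1.
Qed.

(** In characteristic [p] the values of [eps] are [p]-th roots of unity, so conjugation inverts
    them. *)
Lemma eps_conj t : (eps t)^*%C = eps (- t).
Proof.
have [p p_pr charFp] := finPcharP F.
have epsX k : eps (t *+ k) = eps t ^+ k.
  by elim: k => [|k IHk]; rewrite ?eps0 // mulrS epsD IHk exprS.
have norm1 : `|eps t| = 1.
  apply/eqP; rewrite -(pexpr_eq1 (prime_gt0 p_pr)) //.
  by rewrite -normrX -epsX mulrn_pchar // eps0 normr1.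
apply: (mulfI (eps_neq0 t)).
by rewrite -normCK norm1 expr1n -epsD subrr eps0.
Qed.

Lemma sum_eps_trform Y : in_ua Y ->
  \sum_(X | in_ua X) eps (trform Y X) = (if Y == 0 then #|U|%:R else 0).
Proof.
move=> uY; have [-> | nzY] := eqVneq Y 0.
  rewrite -[RHS](@sumr_const _ _ (mem U) 1) [RHS](sum_Ua (fun=> 1)); apply: eq_bigr => X _.
  by rewrite trformC trform0r eps0.
have [X0 uX0 YX0] := trform_nondeg uY nzY; have [t t_neq1] := eps_nontriv.
(* Translation by [X1] multiplies the sum by [eps t], which differs from 1, so the sum is zero. *)
pose X1 : gl := t *: (X0 : M); have uX1 : in_ua X1 by apply: in_uaZ.
have YX1 : trform Y X1 = t.
  by rewrite /trform -scalemxAr mxtraceZ -[\tr _]/(trform Y X0) YX0 mulr1.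
set S := \sum_(X | _) _; have : S * eps t = S.
  rewrite [RHS](reindex_inj (addIr X1)) mulr_suml; apply: eq_big => [X|X _].
    by rewrite in_ua_addr.
  by rewrite trformDr epsD YX1.
move/eqP; rewrite -subr_eq0 -[X in _ - X]mulr1 -mulrBr mulf_eq0 subr_eq0.
by rewrite (negPf t_neq1) orbF => /eqP.
Qed.

(** The linear character of the right stabilizer of [Z], evaluated at [1 + X] and extended by
    zero. *)
Definition stab_term Z X := if Z * X == 0 then eps (trform Z X) else 0.

(** For [g = 1 + W], invariance gives [trform (g * Z) X = trform Z X + trform (Z * X) W]; the sum
    over [W] detects whether [Z * X] vanishes. *)
Lemma sum_left_translates Z X : in_ua Z -> in_ua X ->
  \sum_(g in U) eps (trform (val g * Z) X) = stab_term Z X *+ #|U|.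
Proof.
move=> uZ uX; transitivity (eps (trform Z X) * \sum_(W | in_ua W) eps (trform (Z * X) W)).
  rewrite -sum_Ua mulr_sumr; apply: eq_bigr => g; rewrite inE => ug.
  rewrite trformMr // -epsD -trformDr trformMl //.
  by rewrite mulrBr mulr1 addrC subrK.
rewrite sum_eps_trform ?in_uaMr // /stab_term.
by case: ifP => _; rewrite ?mulr_natr // mulr0 mul0rn.
Qed.

(** The condition says [Y * val u = Y]: this is the right stabilizer of [Y]. *)
Lemma stab_group_set Y : group_set [set u in U | Y * (val u - 1) == 0].
Proof.
apply/group_setP; split=> [|u v]; first by rewrite inE group1 subrr mulr0 eqxx.
move=> /setIdP[uU /eqP Yu] /setIdP[vU /eqP Yv].
apply/setIdP; split; first exact: groupM.
have -> : val u * val v - 1 = (val u - 1) * val v + (val v - 1) :> gl.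
  by rewrite mulrBl mul1r addrA subrK.
by rewrite mulrDr mulrA Yu Yv mul0r addr0.
Qed.
Definition stab Y := Group (stab_group_set Y).

Lemma stab_sub Y : stab Y \subset U.
Proof. by apply/subsetP=> u; rewrite inE => /andP[]. Qed.

Definition stab_repr_fun Y (u : GLa) : 'M[algC]_1 := (eps (trform Y (val u - 1)))%:M.

Lemma stab_mx_repr Y : in_ua Y -> mx_repr (stab Y) (stab_repr_fun Y).
Proof.
move=> uY; split=> [|u v]; first by rewrite /stab_repr_fun subrr trform0r eps0.
move=> /setIdP[uU /eqP Yu] /setIdP[vU /eqP Yv].
rewrite /stab_repr_fun -scalar_mxM -epsD.
(* In this splitting the factor [val u] is absorbed by [Y], which makes [eps] multiplicative on the
   stabilizer. *)
have -> : val (u * v)%g - 1 = (val u - 1) + val u * (val v - 1) :> gl.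
  by rewrite mulrBr mulr1 [RHS]addrC subrKA.
have uv : in_ua (val v - 1) by rewrite inE in vU.
rewrite trformDr -trformMr //.
have -> // : Y * val u = Y by apply/eqP; rewrite -subr_eq0 -{2}[Y]mulr1 -mulrBr Yu.
Qed.

Lemma card_right_orbit Y :
  (#|orbit (biact_action F I) (setX [1 GLa] U) Y| * #|stab Y| = #|U|)%N.
Proof.
have <- : #|setX [1 GLa] U| = #|U| by rewrite cardsX cards1 mul1n.
rewrite -(card_orbit_stab (biact_action F I) _ Y); congr (_ * _)%N.
rewrite -[#|stab Y|]mul1n -(cards1 (1 : GLa)%g) -cardsX; apply: eq_card => -[a b].
rewrite !inE /= sub1set inE /= -!andbA; have [-> | //] := eqVneq a 1%g.
by rewrite /= biact1l mulrBr mulr1 subr_eq0.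
Qed.

(* The class function attached to the U-biorbit of Y is induced from the
   linear character u |-> eps (tr (Y (u - 1))) of the right stabilizer of Y. *)
Lemma orbit_character Y : in_ua Y -> exists2 phi : 'CF(U), phi \is a character &
  {in U, forall u, phi u = #|orbit (biact_action F I) (setX [1 GLa] U) Y|%:R
    / #|orbit (biact_action F I) (setX U U) Y|%:R
    * \sum_(Z in orbit (biact_action F I) (setX U U) Y) eps (trform Z (val u - 1))}.
Proof.
move=> uY; exists ('Ind[U] (cfRepr (MxRepresentation (stab_mx_repr uY)))).
  by rewrite cfInd_char ?cfRepr_char.
move=> u Uu; have uX : in_ua (val u - 1) by rewrite inE in Uu.
set X := val u - 1; rewrite -/X in uX.
rewrite cfIndE ?stab_sub //.
(* Conjugating the argument by [g] amounts to translating [Y] by the inverse of [g]. *)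
have phiE g : g \in U ->
    cfRepr (MxRepresentation (stab_mx_repr uY)) (u ^ g)%g = stab_term (Y * val g^-1%g) X.
  move=> Ug; rewrite cfunE /= mxtrace_scalar mulr1n.
  rewrite inE groupJ //=.
  have -> : val (u ^ g)%g - 1 = val g^-1%g * X * val g.
    rewrite conjgE !FinRing.val_unitM mulrBr mulr1 mulrBl mulrA.
    by rewrite -(FinRing.val_unitM g^-1%g g) mulVg.
  rewrite /stab_term !mulrA.
  have -> : (Y * val g^-1%g * X * val g == 0) = (Y * val g^-1%g * X == 0).
    apply/eqP/eqP=> [e | ->]; last by rewrite mul0r.
    by rewrite -[LHS](mulrK (valP g)) e mul0r.
  case: eqP => [YX0 | _]; last by rewrite mulr0n.
  rewrite mulr1n; congr eps.
  rewrite -mulrA -trformMr ?in_uaMr //.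
  (* The second summand pairs to zero with [Y * val g^-1], since [Y * val g^-1 * X = 0] here. *)
  have -> : X * val g = X + X * (val g - 1) by rewrite mulrBr mulr1 addrC subrK.
  have ug : in_ua (val g - 1) by rewrite inE in Ug.
  by rewrite trformDr -trformMr ?in_uaMr // YX0 [trform 0 _]trformC trform0r addr0.
rewrite (eq_bigr _ phiE).
set GY := orbit _ (setX U U) Y; set c := #|('C_(setX U U)[Y | biact_action F I])%g|.
set T := \sum_(g in U) _; set S := \sum_(Z in GY) _.
(* The sum over [U] times [U] in two ways: by orbit and stabilizer it is [c] copies of [S]; summing
   over the left factor first turns it into stabilizer terms, hence into [T]. *)
have sumUU : S * c%:R = T * #|U|%:R.
  rewrite mulr_natr -(sum_act (biact_action F I) (setX_group U U)).
  transitivity (\sum_(h in U) \sum_(g in U)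
      eps (trform (val g^-1%g * (Y * val h)) X)).
    rewrite exchange_big pair_big; apply: eq_big => [[g h] | [g h] _] /=.
      by rewrite inE.
    by rewrite mulrA.
  rewrite mulr_natr -sumrMnl (reindex_inj invg_inj) /T; apply: eq_big => [h | h Uh].
    by rewrite groupV.
  rewrite -sum_left_translates ?in_uaMr // (reindex_inj invg_inj).
  apply: eq_big => [g | g _]; first by rewrite groupV.
  by rewrite invgK.
have cardUU : (#|GY| * c = #|U| * #|U|)%N.
  by rewrite -cardsX; apply: (card_orbit_stab (biact_action F I) (setX_group U U) Y).
have cardU := card_right_orbit Y.
have c0 : c%:R != 0 :> algC by rewrite pnatr_eq0 -lt0n cardG_gt0.
have s0 : #|stab Y|%:R != 0 :> algC by rewrite pnatr_eq0 -lt0n cardG_gt0.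
have u0 : #|U|%:R != 0 :> algC by rewrite pnatr_eq0 -lt0n cardG_gt0.
have -> : S = T * #|U|%:R / c%:R by rewrite -sumUU mulfK.
have -> : #|GY|%:R = #|U|%:R * #|U|%:R / c%:R :> algC.
  by rewrite -natrM -cardUU natrM mulfK.
have -> : #|orbit (biact_action F I) (setX [1 GLa] U) Y|%:R
    = #|U|%:R / #|stab Y|%:R :> algC.
  by rewrite -cardU natrM mulfK.
by field; rewrite c0 s0 u0.
Qed.

(** * Biorbits under the whole of [GLa] *)

Local Notation GG := (setX [set: GLa] [set: GLa]).
Local Notation orb S Y := (orbit (biact_action F I) S Y).

Lemma orb_refl (A B : {group GLa}) Y : Y \in orb (setX A B) Y.
Proof. exact: (orbit_refl (biact_action F I) (setX_group A B)). Qed.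

Lemma orb_eqP (A B : {group GLa}) Y Z :
  reflect (orb (setX A B) Y = orb (setX A B) Z) (Y \in orb (setX A B) Z).
Proof. exact: (orbit_eqP (to := biact_action F I) (G := setX_group A B)). Qed.

Lemma dual_of_inj_orbit (S : {group GLa * GLa}) Y : in_ua Y ->
  {in orb S Y &, injective (@dual_of F n I)}.
Proof.
move=> uY Z Z' YZ YZ'.
by apply: dual_of_inj; [apply: in_ua_orbit uY YZ | apply: in_ua_orbit uY YZ'].
Qed.

Lemma zetaE D u : rook_placement I D -> u \in U ->
  let Y := X_ F I (transpose_pl D) in
  zeta I eps D u = #|orb (setX [1 GLa] U) Y|%:R / #|orb GG Y|%:R
    * \sum_(Z in orb GG Y) eps (trform Z (val u - 1)).
Proof.
move=> rD Uu Y; have uY : in_ua Y by apply/in_ua_X/rook_transpose_pl.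
rewrite cfunE /zeta_fun Uu Lambda_dual_of rorbit_dual_of //.
rewrite (biorbit_dual_of [set: GLa]%G) //.
have inj S := @dual_of_inj_orbit S _ uY.
rewrite (card_in_imset (inj (setX_group _ _))) (card_in_imset (inj (setX_group _ _))).
rewrite (big_imset _ (inj (setX_group _ _))) /=.
by congr (_ * _); apply: eq_bigr => Z _; rewrite ffunE ua_ofK.
Qed.

Lemma nb_Ua_orbitsE D : rook_placement I D ->
  nb_Ua_orbits F I D =
  #|[set orb (setX U U) Z | Z in orb GG (X_ F I (transpose_pl D))]|.
Proof.
move=> rD; set Y := X_ F I _.
have uY : in_ua Y by apply/in_ua_X/rook_transpose_pl.
have uZ Z : Z \in orb GG Y -> in_ua Z by apply: (@in_ua_orbit _ _ _ (setX_group _ _)).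
rewrite /nb_Ua_orbits Lambda_dual_of (biorbit_dual_of [set: GLa]%G) //.
rewrite -imset_comp.
rewrite (eq_in_imset (g := fun Z => (@dual_of F n I) @: orb (setX U U) Z)); last first.
  by move=> Z /uZ uaZ /=; rewrite biorbit_dual_of.
rewrite (imset_comp (fun O : {set gl} => (@dual_of F n I) @: O)) [LHS]card_in_imset //.
move=> _ _ /imsetP[Z1 /uZ uZ1 ->] /imsetP[Z2 /uZ uZ2 ->] eq12.
apply/orb_eqP.
have : dual_of Z1 \in (@dual_of F n I) @: orb (setX U U) Z1.
  by apply/imsetP; exists Z1; first exact: orb_refl.
rewrite eq12 => /imsetP[Z OZ eqZ].
suff -> : Z1 = Z by exact: OZ.
by apply: dual_of_inj eqZ; [exact: uZ1 | exact: in_ua_orbit uZ2 OZ].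
Qed.

Lemma Ua_normal : U <| [set: GLa].
Proof.
apply/andP; split; first exact: subsetT.
apply/subsetP=> g _; rewrite inE; apply/subsetP=> _ /imsetP[u Uu ->].
rewrite inE conjgE !FinRing.val_unitM.
have -> : val g^-1%g * (val u * val g) - 1 = val g^-1%g * (val u - 1) * val g :> gl.
  rewrite mulrBr mulr1 mulrBl mulrA.
  by rewrite -(FinRing.val_unitM g^-1%g g) mulVg.
by rewrite inE in Uu; rewrite in_uaMr ?in_uaMl.
Qed.

(** A translate of an orbit is an orbit of the conjugate group, which is the same group by
    normality. *)
Lemma card_orbit_biact (A B : {group GLa}) Y a :
  A <| [set: GLa] -> B <| [set: GLa] ->
  #|orb (setX A B) (biact_action F I Y a)| = #|orb (setX A B) Y|.
Proof.
move=> nA nB; have nAB : (setX A B :^ a)%g = setX A B; last first.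
  have := setact_orbit (biact_action F I) (setX A B) Y a; rewrite nAB => eq_orb.
  have := card_setact (biact_action F I) (orb (setX A B) Y) a.
  exact: etrans (congr1 (fun S : {set gl} => #|S|) (esym eq_orb)).
case: a => g h; apply/setP=> -[x y]; rewrite mem_conjg.
have -> : ((x, y) ^ (g, h)^-1)%g = ((x ^ g^-1)%g, (y ^ h^-1)%g) by [].
rewrite !in_setX /= -!mem_conjg.
by rewrite (normsP (normal_norm nA)) ?inE // (normsP (normal_norm nB)) ?inE.
Qed.

(** The large biorbit splits into [U]-biorbits of equal size, whose right [U]-orbits also have equal
    size. Adding up their characters keeps one common coefficient; expressing it through the size of
    the large biorbit produces the number of pieces as a factor. *)
Lemma biorbit_character Y : in_ua Y -> exists2 phi : 'CF(U), phi \is a character &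
  {in U, forall u, phi u = #|[set orb (setX U U) Z | Z in orb GG Y]|%:R
    * (#|orb (setX [1 GLa] U) Y|%:R / #|orb GG Y|%:R
       * \sum_(Z in orb GG Y) eps (trform Z (val u - 1)))}.
Proof.
move=> uY; set P := imset _ _.
have partP : partition P (orb GG Y).
  apply: (orbit_partition (G := setX_group U U)).
  have actGG := acts_orbit (biact_action F I) Y
    (subsetT (setX_group [set: GLa] [set: GLa])).
  by apply: subset_trans actGG; apply: setXS; apply: subsetT.
have card_orb (A B : {group GLa}) Z : A <| [set: GLa] -> B <| [set: GLa] ->
    Z \in orb GG Y -> #|orb (setX A B) Z| = #|orb (setX A B) Y|.
  by move=> nA nB /imsetP[a _ ->]; apply: card_orbit_biact nA nB.
have cardP : {in P, forall O : {set gl}, #|O| = #|orb (setX U U) Y|}.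
  by move=> _ /imsetP[Z GZ ->]; apply: card_orb GZ; apply: Ua_normal.
have /fin_all_exists[phi phiP] (O : {set gl}) : exists phi : 'CF(U), O \in P ->
    phi \is a character /\ {in U, forall u, phi u =
      #|orb (setX [1 GLa] U) Y|%:R / #|orb (setX U U) Y|%:R
      * \sum_(Z in O) eps (trform Z (val u - 1))}.
  have [PO | _] := boolP (O \in P); last by exists 0.
  have [Z GZ eqO] := imsetP PO.
  have uZ : in_ua Z by apply: (@in_ua_orbit _ _ _ (setX_group _ _)) GZ.
  have [phi cphi phiE] := orbit_character uZ.
  exists phi => _; split; first exact: cphi.
  move=> u Uu; rewrite (phiE u Uu) eqO.
  have eq_ratio (a a' b b' : nat) (s : algC) :
    a = a' -> b = b' -> a%:R / b%:R * s = a'%:R / b'%:R * s by move=> -> ->.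
  apply: eq_ratio; first exact: (card_orb 1%G _ _ (normal1 _) Ua_normal GZ).
  exact: card_orb Ua_normal Ua_normal GZ.
exists (\sum_(O in P) phi O); first by apply: rpred_sum => O /phiP[].
move=> u Uu; rewrite sum_cfunE.
rewrite (eq_bigr (fun O : {set gl} => #|orb (setX [1 GLa] U) Y|%:R / #|orb (setX U U) Y|%:R
      * \sum_(Z in O) eps (trform Z (val u - 1)))); last first.
  by move=> O /phiP[_ ->].
rewrite -mulr_sumr -(set_partition_big _ partP) /=.
rewrite (card_uniform_partition cardP partP) natrM.
have p0 : #|P|%:R != 0 :> algC.
  rewrite pnatr_eq0 cards_eq0; apply/set0Pn; exists (orb (setX U U) Y).
  by apply/imsetP; exists Y; first exact: orb_refl.
have s0 : #|orb (setX U U) Y|%:R != 0 :> algC.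
  rewrite pnatr_eq0 cards_eq0; apply/set0Pn; exists Y.
  exact: orb_refl.
by field; rewrite p0 s0.
Qed.

Lemma zeta_character D : rook_placement I D ->
  (nb_Ua_orbits F I D)%:R *: zeta I eps D \is a character.
Proof.
move=> rD; have [|phi cphi phiE] := @biorbit_character (X_ F I (transpose_pl D)).
  exact/in_ua_X/rook_transpose_pl.
suff -> : (nb_Ua_orbits F I D)%:R *: zeta I eps D = phi by exact: cphi.
by apply/cfun_inP=> u Uu; rewrite cfunE (zetaE rD Uu) (phiE u Uu) nb_Ua_orbitsE.
Qed.

Lemma zeta_neq0 D : rook_placement I D ->
  (nb_Ua_orbits F I D)%:R *: zeta I eps D != 0.
Proof.
move=> rD; set Y := X_ F I (transpose_pl D).
have card_orb_neq0 (A B : {group GLa}) Z : #|orb (setX A B) Z|%:R != 0 :> algC.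
  rewrite pnatr_eq0 cards_eq0; apply/set0Pn; exists Z; exact: orb_refl.
apply/eqP=> zeta0; have : ((nb_Ua_orbits F I D)%:R *: zeta I eps D) 1%g = 0.
  by rewrite zeta0 cfunE.
rewrite cfunE (zetaE rD (group1 U)) nb_Ua_orbitsE //.
(* At the identity the sum equals the size of the biorbit and cancels the denominator, leaving a
   product of nonzero cardinals. *)
rewrite (eq_bigr (fun=> 1)) => [|Z _]; last by rewrite subrr trform0r eps0.
rewrite sumr_const divfK; last exact: card_orb_neq0.
apply/eqP; rewrite mulf_neq0 //; last exact: card_orb_neq0.
rewrite pnatr_eq0 cards_eq0; apply/set0Pn; exists (orb (setX U U) Y).
by apply/imsetP; exists Y; first exact: orb_refl.
Qed.

(** Each pair contributes the sum of the additive character of [Z - Z'], which is nonzero by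
    disjointness, so the contribution vanishes. *)
Lemma sum_biorbit_orthogonal (S S' : {set gl}) :
    {in S, forall Z, in_ua Z} -> {in S', forall Z, in_ua Z} -> [disjoint S & S'] ->
  \sum_(u in U) (\sum_(Z in S) eps (trform Z (val u - 1)))
    * (\sum_(Z in S') eps (trform Z (val u - 1)))^*%C = 0.
Proof.
move=> uS uS' disjSS'.
transitivity (\sum_(Z in S) \sum_(Z' in S') \sum_(u in U)
    eps (trform (Z - Z') (val u - 1))).
  rewrite exchange_big; under [RHS]eq_bigr do rewrite exchange_big.
  rewrite exchange_big; apply: eq_bigr => u _; rewrite rmorph_sum big_distrlr exchange_big.
  apply: eq_bigr => Z' _; apply: eq_bigr => Z _.
  by rewrite trformBl epsD -eps_conj.
apply: big1 => Z SZ; apply: big1 => Z' SZ'.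
have uZZ' : in_ua (Z - Z').
  by rewrite -(in_ua_addr (Z - Z') (uS' _ SZ')) subrK uS.
rewrite (sum_Ua (fun X => eps (trform (Z - Z') X))) sum_eps_trform // subr_eq0.
case: eqP => // eqZ; rewrite -eqZ in SZ'.
by rewrite (disjointFr disjSS' SZ) in SZ'.
Qed.

Lemma biorbits_disjoint D D' : rook_placement I D -> rook_placement I D' ->
  D' \notin WL_orbit I D -> [disjoint orb GG (X_ F I D) & orb GG (X_ F I D')].
Proof.
move=> rD rD' nDD'; apply/pred0P=> Z /=; apply: contraNF nDD' => /andP[YZ YZ'].
have /imsetP[a _ eqD'] : X_ F I D' \in orb GG (X_ F I D).
  by apply/orb_eqP; rewrite -(orb_eqP _ _ _ _ YZ) -(orb_eqP _ _ _ _ YZ').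
exact: (rook_unique rD rD' eqD').
Qed.

Lemma zeta_orthogonal D D' : rook_placement I D -> rook_placement I D' ->
  D' \notin WL_orbit I D -> '[zeta I eps D, zeta I eps D'] = 0.
Proof.
move=> rD rD' nDD'.
have rT := rook_transpose_pl rD; have rT' := rook_transpose_pl rD'.
have uT := @in_ua_orbit _ _ _ (setX_group [set: GLa] [set: GLa]) _ _ (in_ua_X F rT).
have uT' := @in_ua_orbit _ _ _ (setX_group [set: GLa] [set: GLa]) _ _ (in_ua_X F rT').
have disj : [disjoint orb GG (X_ F I (transpose_pl D))
                    & orb GG (X_ F I (transpose_pl D'))].
  (* [Lambda] corresponds to transposed placements, so inequivalence is carried over to the
     transposes. *)
  by apply: biorbits_disjoint => //; apply: contra nDD'; apply: WL_orbit_transpose_pl.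
rewrite cfdotE; have sum0 := sum_biorbit_orthogonal uT uT' disj.
under eq_bigr => u Uu do rewrite (zetaE rD Uu) (zetaE rD' Uu) rmorphM mulrACA.
by rewrite -mulr_sumr sum0 !mulr0.
Qed.

Lemma zeta_biorbit D x y a : rook_placement I D -> x \in U -> y \in U ->
  val x - 1 = biact (val y - 1) a -> zeta I eps D x = zeta I eps D y.
Proof.
move=> rD Ux Uy eqx; rewrite (zetaE rD Ux) (zetaE rD Uy) eqx; congr (_ * _).
set Y := X_ F I _.
have uY : in_ua Y by apply/in_ua_X/rook_transpose_pl.
(* By invariance, [g^-1 * X * h] pairs with [Z] as [X] does with [h * Z * g^-1]; this is
   [biact Z (h^-1, g^-1)], and it permutes the biorbit. *)
pose b : GLa * GLa := (a.2^-1, a.1^-1)%g.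
rewrite [RHS](reindex_inj (act_inj (biact_action F I) b)).
apply: eq_big => [Z | Z YZ].
  by rewrite (orbit_actr (biact_action F I) (G := setX_group _ _)) // !inE.
have uZ := @in_ua_orbit _ _ _ (setX_group [set: GLa] [set: GLa]) _ _ uY YZ.
have uy : in_ua (val y - 1) by rewrite inE in Uy.
congr eps; rewrite -[RHS]/(trform (val a.2^-1^-1%g * Z * val a.1^-1%g) _).
by rewrite invgK trformMr ?in_uaMl // trformMl ?in_uaMl // /biact mulrA.
Qed.

End Characters.
End BiorbitCharacters.

(** * Superclasses *)

Section Superclasses.
Variables (F : finFieldType) (n : nat) (I : segments n).
Local Notation gl := (gla F I).
Local Notation GLa := {unit gl}.
Local Notation U := (Ua F I).
Implicit Types (D : {set 'I_n * 'I_n}) (R : {set {set 'I_n * 'I_n}}).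

Local Notation act := (biact_action F I).

Lemma superclassP D (u : GLa) :
  reflect (exists a, val u - 1 = act (X_ F I D) a) (u \in superclass F I D).
Proof.
rewrite inE; apply: (iffP existsP) => [[g /existsP[h /eqP uE]] | [[g h] uE]].
  by exists (g^-1, h)%g; rewrite uE addrC addKr /= /biact invgK.
exists g^-1%g; apply/existsP; exists h; apply/eqP.
by rewrite -[X in 1 + X]uE addrC subrK.
Qed.

Lemma superclass_sub_Ua D : rook_placement I D -> superclass F I D \subset U.
Proof.
move=> rD; apply/subsetP=> u /superclassP[a uE].
by rewrite inE uE in_ua_biact in_ua_X.
Qed.

Lemma superclass_neq0 D : rook_placement I D -> superclass F I D != set0.
Proof.
move=> rD; apply/set0Pn; exists (FinRing.unit gl (unit_1ua (in_ua_X F rD))).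
by apply/superclassP; exists 1%g; rewrite act1 /= addrC addKr.
Qed.

Lemma superclass_act D (x y : GLa) :
    x \in superclass F I D -> y \in superclass F I D ->
  exists a, val x - 1 = act (val y - 1) a.
Proof.
move=> /superclassP[a ->] /superclassP[b ->].
by exists (b^-1 * a)%g; rewrite actM actK.
Qed.

Lemma superclass_meet D D' (u : GLa) : rook_placement I D -> rook_placement I D' ->
  u \in superclass F I D -> u \in superclass F I D' -> D' \in WL_orbit I D.
Proof.
move=> rD rD' /superclassP[a uE] /superclassP[b]; rewrite uE => eqab.
have eqX : X_ F I D' = act (X_ F I D) (a * b^-1)%g by rewrite actM eqab actK.
exact: (rook_unique rD rD' eqX).
Qed.

Lemma superclass_exists (u : GLa) : u \in U ->
  exists2 D, rook_placement I D & u \in superclass F I D.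
Proof.
rewrite inE => /exists_rook[g [h [D rD uE]]]; exists D => //.
by apply/superclassP; exists (g^-1, h)%g; rewrite uE /= /biact invgK.
Qed.

Lemma superclass_WL_orbit D D' : D' \in WL_orbit I D ->
  superclass F I D \subset superclass F I D'.
Proof.
case/(@X_WL_orbit F)=> g [h eqX]; apply/subsetP=> u /superclassP[a uE].
have {}eqX : X_ F I D' = act (X_ F I D) (g^-1, h)%g by rewrite eqX /= /biact invgK.
by apply/superclassP; exists ((g^-1, h)^-1 * a)%g; rewrite uE actM eqX actK.
Qed.

Lemma WL_orbit_refl D : D \in WL_orbit I D.
Proof.
have WL1 : 1%g \in WL I by rewrite mem_WL; apply/forallP=> i; rewrite perm1.
apply/imset2P; exists 1%g 1%g => //; rewrite /WL_act -[LHS]imset_id.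
by apply: eq_imset => -[i j]; rewrite invg1 !perm1.
Qed.

Lemma rook_placement0 : rook_placement I set0.
Proof. by apply/rook_placementP; split=> [r | r s]; rewrite inE. Qed.

Lemma WL_orbit0 D : D \in WL_orbit I set0 -> D = set0.
Proof. by case/imset2P=> w1 w2 _ _ ->; rewrite /WL_act imset0. Qed.

Lemma superclass0 : superclass F I set0 = [set 1%g].
Proof.
apply/setP=> u; rewrite [RHS]inE; apply/superclassP/eqP => [[a] | ->].
  rewrite /= /biact /X_ big_set0 mulr0 mul0r => /eqP.
  by rewrite subr_eq0 => /eqP u1; apply: val_inj.
by exists 1%g; rewrite act1 /X_ big_set0 subrr.
Qed.

(** * Superclasses of a system of representatives *)

Section Representatives.
Variable R : {set {set 'I_n * 'I_n}}.
Hypothesis reprR : rook_representatives I R.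

Lemma representative_rook D : D \in R -> rook_placement I D.
Proof. by have /and3P[_ /subsetP sR _] := reprR => /sR; rewrite inE. Qed.

Let card_meet D : rook_placement I D -> #|R :&: WL_orbit I D| = 1%N.
Proof.
by move=> rD; have /and3P[_ _ /forall_inP tr] := reprR; apply/eqP/tr/imset_f.
Qed.

Lemma representative_exists D : rook_placement I D ->
  exists2 D0, D0 \in R & D0 \in WL_orbit I D.
Proof.
move=> rD; have /cards1P[D0 eqR] : #|R :&: WL_orbit I D| == 1%N by rewrite card_meet.
have : D0 \in R :&: WL_orbit I D by rewrite eqR set11.
by case/setIP; exists D0.
Qed.

Lemma representative_unique D D' : D \in R -> D' \in R -> D' \in WL_orbit I D -> D = D'.
Proof.
move=> RD RD' DD'.
have /cards1P[D0 eqR] : #|R :&: WL_orbit I D| == 1%N.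
  by rewrite card_meet ?representative_rook.
have : D \in R :&: WL_orbit I D by rewrite inE RD WL_orbit_refl.
have : D' \in R :&: WL_orbit I D by rewrite inE RD' DD'.
by rewrite eqR !inE => /eqP-> /eqP->.
Qed.

Lemma superclass_representative_eq D D' (u : GLa) : D \in R -> D' \in R ->
  u \in superclass F I D -> u \in superclass F I D' -> D = D'.
Proof.
move=> RD RD' uD uD'; apply: representative_unique => //.
by apply: superclass_meet uD uD'; apply: representative_rook.
Qed.

Lemma superclass_inj : {in R &, injective (superclass F I)}.
Proof.
move=> D D' RD RD' eqK.
have /set0Pn[u uD] := superclass_neq0 (representative_rook RD).
by apply: (superclass_representative_eq RD RD' uD); rewrite -eqK.
Qed.

Lemma superclass_partition : partition [set superclass F I D | D in R] U.
Proof.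
apply/and3P; split.
- rewrite eqEsubset; apply/andP; split.
    apply/bigcupsP=> _ /imsetP[D RD ->].
    exact/superclass_sub_Ua/representative_rook.
  apply/subsetP=> u /superclass_exists[D rD uD].
  have [D0 RD0 D0D] := representative_exists rD.
  apply/bigcupP; exists (superclass F I D0); first exact: imset_f.
  exact: subsetP (superclass_WL_orbit D0D) u uD.
- apply/trivIsetP=> _ _ /imsetP[D RD ->] /imsetP[D' RD' ->] neqK.
  apply/pred0P=> u /=; apply: contraNF neqK => /andP[uD uD'].
  by rewrite (superclass_representative_eq RD RD' uD uD').
- apply/imsetP=> -[D RD /esym/eqP]; apply/negP/superclass_neq0.
  exact: representative_rook.
Qed.

End Representatives.
End Superclasses.

Theorem theorem3p6 (F : finFieldType) (n : nat) (I : segments n)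
    (eps : F -> algC) (R : {set {set 'I_n * 'I_n}}) :
  2%N \notin [pchar F] ->
  {morph eps : s t / s + t >-> s * t} ->
  (forall t, eps t != 0) ->
  (exists t, eps t != 1) ->
  rook_representatives I R ->
  supercharacter_theory R
    (fun D => (nb_Ua_orbits F I D)%:R *: zeta I eps D)
    (superclass F I).
Proof.
move=> _ epsD eps_neq0 eps_nontriv reprR.
have rookR := representative_rook reprR.
have charR D : D \in R -> (nb_Ua_orbits F I D)%:R *: zeta I eps D \is a character.
  by move=> /rookR rD; apply: zeta_character.
split.
- move=> D RD; split; first exact: charR.
  by apply: zeta_neq0 => //; apply: rookR.
- move=> D D' RD RD' neqDD'; apply/pred0P=> i /=; apply/negP=> /andP[Di D'i].
  have orthDD' : '[(nb_Ua_orbits F I D)%:R *: zeta I eps D,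
                   (nb_Ua_orbits F I D')%:R *: zeta I eps D'] = 0.
    rewrite cfdotZl cfdotZr zeta_orthogonal ?mulr0 //; try exact: rookR.
    by apply: contra neqDD' => /(representative_unique reprR RD RD')->.
  (* Orthogonal characters have orthogonal constituents, so a common one would have norm 0 instead
     of 1. *)
  have := constt_ortho_char (charR D RD) (charR D' RD') Di D'i orthDD'.
  by move/eqP; rewrite cfnorm_irr oner_eq0.
- by split; [apply: superclass_inj | apply: superclass_partition].
(* The empty placement is alone in its orbit, so it belongs to [R]; its class is the identity. *)
- have [D RD /WL_orbit0 D0] := representative_exists reprR (rook_placement0 I).
  by apply/imsetP; exists D; rewrite // D0 superclass0.
move=> D D' RD RD' x y Kx Ky; rewrite [LHS]cfunE [RHS]cfunE; congr (_ * _).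
have /subsetP sKU := @superclass_sub_Ua F n I D' (rookR _ RD').
have [a eqx] := superclass_act Kx Ky.
by apply: zeta_biorbit eqx; [apply: rookR | apply: sKU | apply: sKU].
Qed.
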